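(* Let $X$ and $Y$ be Banach spaces over $\mathbb K\in\{\mathbb R,\mathbb C\}$. If $X$ and $Y$ are both infinite-dimensional, then $$C_{\mathrm{NJ}}(X\widehat\otimes_{\varepsilon}Y)=C_{\mathrm{NJ}}(X\widehat\otimes_{\pi}Y)=2.$$ Consequently, if $C_{\mathrm{NJ}}(X\widehat\otimes_{\varepsilon}Y)\neq C_{\mathrm{NJ}}(X\widehat\otimes_{\pi}Y)$, then at least one of $X,Y$ is finite-dimensional.
   Context: For a Banach space $X$, the von Neumann--Jordan constant is $$C_{\mathrm{NJ}}(X)=\sup\left\{\frac{\|x+y\|^{2}+\|x-y\|^{2}}{2(\|x\|^{2}+\|y\|^{2})}: x,y\in X,\ (x,y)\neq(0,0)\right\}.$$ For Banach spaces $X,Y$ over $\mathbb K$, and $w=\sum_{j=1}^r x_j\otimes y_j$ in the algebraic tensor product $X\otimes Y$, the injective norm is $\|w\|_\varepsilon=\sup\{|\sum_{j} x^*(x_j)y^*(y_j)|: x^*\in B_{X^*},\,y^*\in B_{Y^*}\}$ and the projective norm is $\|w\|_\pi=\inf\{\sum_{j}\|x_j\|\|y_j\|: w=\sum_{j} x_j\otimes y_j\}$. The completions of $X\otimes Y$ for these norms are denoted $X\widehat\otimes_\varepsilon Y$ and $X\widehat\otimes_\pi Y$. *)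

(* Defs.v *)
From HB Require Import structures.
From mathcomp Require Import all_boot all_order all_algebra.
From mathcomp Require Import all_classical all_reals all_analysis.
From mathcomp Require Import complex lra.

Set Implicit Arguments.
Unset Strict Implicit.
Unset Printing Implicit Defensive.

Import Order.TTheory GRing.Theory Num.Theory.
Import numFieldNormedType.Exports.

Local Open Scope classical_set_scope.
Local Open Scope ring_scope.
Local Open Scope quotient_scope.

Inductive field_kind := real_kind | complex_kind.

Definition base_field (R : realType) (k : field_kind) : numFieldType :=
  match k with real_kind => R | complex_kind => R[i] end.

(* Norms of a [normedModType K] take their values in [K]; for K = R[i] these
   values are real, and [re_part] and [of_real] mediate between R and K. *)
Definition re_part (R : realType) (k : field_kind) : base_field R k -> R :=
  match k return base_field R k -> R with
  | real_kind => id
  | complex_kind => @complex.Re R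
  end.

Definition of_real (R : realType) (k : field_kind) : R -> base_field R k :=
  match k return R -> base_field R k with
  | real_kind => id
  | complex_kind => fun r => Complex r 0
  end.

Section BaseField.
Variables (R : realType) (k : field_kind).
Implicit Types (r s : R) (a b : base_field R k).

Lemma of_realK : cancel (@of_real R k) (@re_part R k).
Proof. by case: k. Qed.

Lemma re_partK a : 0 <= a -> of_real k (re_part a) = a.
Proof.
case: k a => //= -[x y]; rewrite lecE /= => /andP[/eqP -> _] //.
Qed.

Lemma of_realD r s : of_real k (r + s) = of_real k r + of_real k s.
Proof. by case: k => //=; rewrite /GRing.add /= addr0. Qed.

Lemma of_realM r s : of_real k (r * s) = of_real k r * of_real k s.
Proof. by case: k => //=; rewrite -[LHS]/(r * s)%:C%C rmorphM. Qed.

Lemma of_real0 : of_real k (0 : R) = 0. Proof. by case: k. Qed.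

Lemma ler_of_real r s : (of_real k r <= of_real k s) = (r <= s).
Proof. by case: k => //=; rewrite lecR. Qed.

Lemma ltr_of_real r s : (of_real k r < of_real k s) = (r < s).
Proof. by case: k => //=; rewrite ltcR. Qed.

Lemma re_partD a b : re_part (a + b) = re_part a + re_part b.
Proof. by case: k a b => //= -[? ?] [? ?]. Qed.

Lemma re_part0 : re_part (0 : base_field R k) = 0.
Proof. by case: k. Qed.

Lemma re_part1 : re_part (1 : base_field R k) = 1.
Proof. by case: k. Qed.

Lemma re_part_ge0 a : 0 <= a -> 0 <= re_part a.
Proof. by move=> a0; rewrite -ler_of_real re_partK// of_real0. Qed.

Lemma re_part_gt0 a : 0 < a -> 0 < re_part a.
Proof. by move=> a0; rewrite -ltr_of_real re_partK ?of_real0// ltW. Qed.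

Lemma ler_re_part a b : 0 <= a -> a <= b -> re_part a <= re_part b.
Proof.
by move=> a0 ab; rewrite -ler_of_real !re_partK// (le_trans a0 ab).
Qed.

Lemma re_partM a b : 0 <= a -> 0 <= b -> re_part (a * b) = re_part a * re_part b.
Proof.
move=> a0 b0; apply: (can_inj of_realK); rewrite of_realM !re_partK//.
exact: mulr_ge0.
Qed.

End BaseField.

Definition rnorm (R : realType) (k : field_kind)
  (X : normedZmodType (base_field R k)) (x : X) : R := re_part `|x|.

Section RealNorm.
Variables (R : realType) (k : field_kind) (X : normedZmodType (base_field R k)).
Implicit Types x y : X.

Lemma rnormE x : of_real k (rnorm x) = `|x|.
Proof. exact: re_partK. Qed.

Lemma rnorm_ge0 x : 0 <= rnorm x. Proof. exact: re_part_ge0. Qed.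

Lemma rnorm0 : rnorm (0 : X) = 0. Proof. by rewrite /rnorm normr0 re_part0. Qed.

Lemma rnormD x y : rnorm (x + y) <= rnorm x + rnorm y.
Proof. by rewrite -re_partD ler_re_part// ler_normD. Qed.

End RealNorm.

Lemma rnormM (R : realType) (k : field_kind) (a b : base_field R k) :
  rnorm (a * b) = rnorm a * rnorm b.
Proof. by rewrite /rnorm normrM re_partM. Qed.

Lemma rnormZ (R : realType) (k : field_kind)
    (X : normedModType (base_field R k)) (a : base_field R k) (x : X) :
  rnorm (a *: x) = rnorm a * rnorm x.
Proof. by rewrite /rnorm normrZ re_partM. Qed.

Definition finite_dim (K : fieldType) (V : lmodType K) : Prop :=
  exists (n : nat) (e : 'I_n -> V),
    forall v, exists c : 'I_n -> K, v = \sum_(i < n) c i *: e i.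

(* The supremum is over the empty set, hence equal to -oo, if X is zero. *)
Definition CNJ (R : realType) (k : field_kind)
    (X : completeNormedModType (base_field R k)) : \bar R :=
  ereal_sup [set ((rnorm (p.1 + p.2) ^+ 2 + rnorm (p.1 - p.2) ^+ 2) /
                  (2 * (rnorm p.1 ^+ 2 + rnorm p.2 ^+ 2)))%:E
            | p in [set p : X * X | p <> (0, 0)]].

Record seminorm (R : realType) (k : field_kind)
    (V : lmodType (base_field R k)) := Seminorm {
  seminorm_fun :> V -> R;
  seminormD : forall u v,
    seminorm_fun (u + v) <= seminorm_fun u + seminorm_fun v;
  seminormZ : forall a v, seminorm_fun (a *: v) = rnorm a * seminorm_fun v
}.

Section CauchySequences.
Variables (R : realType) (k : field_kind) (V : lmodType (base_field R k)).
Variable p : seminorm V.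
Implicit Types (u v w : V) (f g : nat -> V).

Lemma seminorm0 : p 0 = 0.
Proof. by rewrite -(scale0r (0 : V)) seminormZ rnorm0 mul0r. Qed.

Lemma seminormN v : p (- v) = p v.
Proof. by rewrite -scaleN1r seminormZ /rnorm normrN normr1 re_part1 mul1r. Qed.

Lemma seminorm_ge0 v : 0 <= p v.
Proof.
have := seminormD p v (- v); rewrite subrr seminorm0 seminormN -mulr2n.
by rewrite pmulrn_lge0.
Qed.

Lemma seminormBC u v : p (u - v) = p (v - u).
Proof. by rewrite -seminormN opprB. Qed.

Lemma seminorm_triangle u v w : p (u - w) <= p (u - v) + p (v - w).
Proof. by rewrite (le_trans _ (seminormD _ _ _))// addrA subrK. Qed.

Lemma seminorm_dist u v : `|p u - p v| <= p (u - v).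
Proof.
rewrite ler_norml lerNl opprB !lerBlDr; apply/andP; split.
  by rewrite seminormBC (le_trans _ (seminormD _ _ _))// subrK.
by rewrite (le_trans _ (seminormD _ _ _))// subrK.
Qed.

Definition cauchy_seq f : Prop := forall e : R, 0 < e ->
  exists N, forall m n, (N <= m)%N -> (N <= n)%N -> p (f m - f n) < e.

Definition null_seq f : Prop := forall e : R, 0 < e ->
  exists N, forall n, (N <= n)%N -> p (f n) < e.

Definition cauchy_pred : {pred (nat -> V)} := [pred f | `[< cauchy_seq f >]].

Lemma cauchy_pred_submod : submod_closed cauchy_pred.
Proof.
split=> [|a f g /asboolP fC /asboolP gC]; apply/asboolP => e e0.
  by exists 0%N => m n _ _ /=; rewrite subr0 seminorm0.
have a1 : 0 < rnorm a + 1 by rewrite ltr_wpDl// rnorm_ge0.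
have [N1 h1] := fC _ (divr_gt0 e0 (mulr_gt0 (ltr0n R 2) a1)).
have [N2 h2] := gC _ (divr_gt0 e0 (ltr0n R 2)).
exists (maxn N1 N2) => m n; rewrite !geq_max => /andP[m1 m2] /andP[n1 n2].
have -> : (a *: f + g) m - (a *: f + g) n = a *: (f m - f n) + (g m - g n).
  by rewrite scalerBr addrACA opprD.
rewrite (le_lt_trans (seminormD _ _ _))// seminormZ [e in _ < e]splitr.
rewrite ler_ltD ?h2//.
have := ltW (h1 _ _ m1 n1); rewrite ler_pdivlMr ?mulr_gt0//.
by have := seminorm_ge0 (f m - f n); lra.
Qed.

HB.instance Definition _ :=
  GRing.isSubmodClosed.Build (base_field R k) (nat -> V) cauchy_pred
    cauchy_pred_submod.

Definition cauchy_space := {f : nat -> V | f \in cauchy_pred}.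
HB.instance Definition _ := SubChoice.on cauchy_space.
HB.instance Definition _ :=
  [SubChoice_isSubLmodule of cauchy_space by <:].
End CauchySequences.

Section Completion.
Variables (R : realType) (k : field_kind) (V : lmodType (base_field R k)).
Variable p : seminorm V.
Local Notation K := (base_field R k).
Local Notation C := (cauchy_space p).
Implicit Types f g : C.

Definition null_pred : {pred C} := [pred f : C | `[< null_seq p (val f) >]].

Lemma null_pred_submod : submod_closed null_pred.
Proof.
split=> [|a f g /asboolP fN /asboolP gN]; apply/asboolP => e e0.
  by exists 0%N => n _ /=; rewrite seminorm0.
have a1 : 0 < rnorm a + 1 by rewrite ltr_wpDl// rnorm_ge0.
have [N1 h1] := fN _ (divr_gt0 e0 (mulr_gt0 (ltr0n R 2) a1)).
have [N2 h2] := gN _ (divr_gt0 e0 (ltr0n R 2)).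
exists (maxn N1 N2) => n; rewrite !geq_max => /andP[n1 n2].
have -> : val (a *: f + g) n = a *: val f n + val g n by [].
rewrite (le_lt_trans (seminormD _ _ _))// seminormZ [e in _ < e]splitr.
rewrite ler_ltD ?h2//.
have := ltW (h1 _ n1); rewrite ler_pdivlMr ?mulr_gt0//.
by have := seminorm_ge0 p (val f n); lra.
Qed.

HB.instance Definition _ :=
  GRing.isSubmodClosed.Build K C null_pred null_pred_submod.

(* Cauchy sequences modulo null sequences; vectors with p v = 0 are identified
   with 0, so that this is the usual completion when p is a norm. *)
Definition completion := @Quotient.quot C null_pred.
HB.instance Definition _ := GRing.Zmodule.on completion.
HB.instance Definition _ := EqQuotient.on completion.

Lemma completion_eqP f g :
  reflect (null_seq p (fun n => val f n - val g n))
    (\pi_completion f == \pi_completion g).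
Proof.
rewrite -(Quotient.idealrBE null_pred).
exact: asboolP.
Qed.

Definition completion_scale (a : K) (x : completion) : completion :=
  \pi_completion (a *: repr x).

Lemma pi_scale a f : completion_scale a (\pi_completion f) = \pi_completion (a *: f).
Proof.
apply/eqP; rewrite -(Quotient.idealrBE null_pred) -scalerBr rpredZ//.
by rewrite (Quotient.idealrBE null_pred) reprK.
Qed.

Lemma pi_completionD f g :
  \pi_completion (f + g) = \pi_completion f + \pi_completion g.
Proof. exact: Quotient.pi_add. Qed.

Lemma completion_scaleA a b (x : completion) :
  completion_scale a (completion_scale b x) = completion_scale (a * b) x.
Proof. by elim/quotW: x => f; rewrite (pi_scale b) !pi_scale scalerA. Qed.

Lemma completion_scale1 : left_id 1 completion_scale.
Proof. by elim/quotW => f; rewrite pi_scale scale1r. Qed.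

Lemma completion_scaleDr : right_distributive completion_scale +%R.
Proof.
move=> a; elim/quotW => f; elim/quotW => g.
by rewrite -pi_completionD !pi_scale -pi_completionD scalerDr.
Qed.

Lemma completion_scaleDl x : {morph completion_scale^~ x : a b / a + b}.
Proof.
by elim/quotW: x => f a b; rewrite !pi_scale -pi_completionD scalerDl.
Qed.

HB.instance Definition _ := GRing.Zmodule_isLmodule.Build K completion
  completion_scaleA completion_scale1 completion_scaleDr completion_scaleDl.

Lemma pi_completionZ a f : \pi_completion (a *: f) = a *: \pi_completion f.
Proof. by rewrite -pi_scale. Qed.

Definition completion_norm (x : completion) : R :=
  limn (fun n => p (val (repr x) n)).

Lemma cauchyE f (e : R) : 0 < e ->
  exists N, forall m n, (N <= m)%N -> (N <= n)%N ->
    p (val f m - val f n) < e.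
Proof. by have /asboolP := valP f; apply. Qed.

Lemma is_cvg_seminorm f : cvgn (fun n => p (val f n)).
Proof.
apply: cauchy_cvg; apply: cauchy_exP => e e0.
have [N hN] := cauchyE f e0; exists (p (val f N)).
exists N => // n /= Nn; rewrite /ball/=.
exact: le_lt_trans (seminorm_dist _ _ _) (hN _ _ _ _).
Qed.

Lemma cvg_completion_norm f :
  p (val f n) @[n --> \oo] --> completion_norm (\pi_completion f).
Proof.
pose g := repr (\pi_completion f).
have gcvg : p (val g n) @[n --> \oo] --> completion_norm (\pi_completion f).
  exact: is_cvg_seminorm.
have /completion_eqP fg : \pi_completion f == \pi_completion g.
  by rewrite reprK.
have: p (val g n) + (p (val f n) - p (val g n)) @[n --> \oo] -->
    completion_norm (\pi_completion f) + 0.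
  apply: cvgD => //; apply/cvgr0Pnorm_lt => e e0.
  have [N hN] := fg e e0; exists N => // n /= Nn.
  exact: le_lt_trans (seminorm_dist _ _ _) (hN _ _).
by rewrite addr0; under eq_fun do rewrite addrC subrK.
Qed.
Arguments cvg_completion_norm : clear implicits.

Lemma completion_normD x y :
  completion_norm (x + y) <= completion_norm x + completion_norm y.
Proof.
elim/quotW: x => f; elim/quotW: y => g; rewrite -pi_completionD.
apply: (ler_cvg_to (cvg_completion_norm (f + g))
  (cvgD (cvg_completion_norm f) (cvg_completion_norm g))).
by apply: nearW => n; exact: seminormD.
Qed.

Lemma completion_normZ a x :
  completion_norm (a *: x) = rnorm a * completion_norm x.
Proof.
elim/quotW: x => f; rewrite -pi_completionZ.
have afE : (fun n => p (val (a *: f) n)) = (fun n => rnorm a * p (val f n)).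
  by apply/funext => n; rewrite -seminormZ.
have := cvg_completion_norm (a *: f); rewrite afE => af.
exact: cvg_unique af (cvgMl_tmp (cvg_completion_norm f)).
Qed.

Lemma completion_norm_eq0 x : completion_norm x = 0 -> x = 0.
Proof.
elim/quotW: x => f f0.
have := cvg_completion_norm f; rewrite f0 => /cvgr0Pnorm_lt fN.
have -> : 0 = \pi_completion 0 :> completion by rewrite pi_zeror.
apply/eqP/completion_eqP => e /fN[N _ hN]; exists N => n Nn.
by rewrite subr0; exact: le_lt_trans (ler_norm _) (hN n Nn).
Qed.

Lemma completion_norm_ge0 x : 0 <= completion_norm x.
Proof.
elim/quotW: x => f; apply: cvgr_to_ge (cvg_completion_norm f) _.
by apply: nearW => n; exact: seminorm_ge0.
Qed.

Let knorm (x : completion) : K := of_real k (completion_norm x).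

Let knormD x y : knorm (x + y) <= knorm x + knorm y.
Proof. by rewrite -of_realD ler_of_real completion_normD. Qed.

Let knormZ a x : knorm (a *: x) = `|a| * knorm x.
Proof. by rewrite /knorm completion_normZ of_realM rnormE. Qed.

Let knorm_eq0 x : knorm x = 0 -> x = 0.
Proof.
move=> /(congr1 (@re_part R k)); rewrite of_realK re_part0.
exact: completion_norm_eq0.
Qed.

HB.instance Definition _ :=
  Lmodule_isNormed.Build K completion knormD knormZ knorm_eq0.

Lemma rnorm_completion x : rnorm x = completion_norm x.
Proof. by rewrite /rnorm [`|x|]/(knorm x) of_realK. Qed.

Lemma const_cauchy v : (fun=> v) \in cauchy_pred p.
Proof.
by apply/asboolP => e e0; exists 0%N => m n _ _; rewrite subrr seminorm0.
Qed.

Definition const_seq (v : V) : C := exist _ (fun=> v) (const_cauchy v).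

Definition to_completion (v : V) : completion := \pi_completion (const_seq v).

Lemma to_completion_is_linear : linear to_completion.
Proof.
move=> a u v; rewrite /to_completion.
rewrite -pi_completionZ -pi_completionD.
by congr \pi_completion; apply: val_inj.
Qed.

HB.instance Definition _ :=
  GRing.isLinear.Build K V completion *:%R to_completion
    to_completion_is_linear.

Lemma rnorm_to_completion v : rnorm (to_completion v) = p v.
Proof.
rewrite rnorm_completion.
have := cvg_completion_norm (const_seq v) => /= vc.
exact: cvg_unique vc (cvg_cst _).
Qed.

Lemma dist_to_completion v f :
  p (v - val f n) @[n --> \oo] --> rnorm (to_completion v - \pi_completion f).
Proof.
rewrite rnorm_completion.
have -> : to_completion v - \pi_completion f =
    \pi_completion (const_seq v - f).
  by rewrite [RHS]raddfB.
exact: cvg_completion_norm.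
Qed.
Arguments dist_to_completion : clear implicits.

Lemma to_completion_dense (x : completion) (e : R) : 0 < e ->
  exists v, rnorm (to_completion v - x) < e.
Proof.
elim/quotW: x => f e0.
have [N hN] := cauchyE f (divr_gt0 e0 (ltr0n R 2)).
exists (val f N).
apply: le_lt_trans (_ : e / 2 < e); last by lra.
apply: cvgr_to_le (dist_to_completion _ _) _.
by exists N => // n /= Nn; exact/ltW/hN.
Qed.

Lemma completion_complete (F : set_system completion) :
  ProperFilter F -> cauchy F -> cvg F.
Proof.
move=> FF Fc.
pose r n : R := n.+1%:R^-1.
have r_gt0 n : 0 < r n by rewrite invr_gt0 ltr0n.
have r_le m n : (m <= n)%N -> r n <= r m.
  by move=> mn; rewrite lef_pV2 ?posrE ?ltr0n// ler_nat.
have approx n : exists v : V, F [set y | rnorm (to_completion v - y) < r n].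
  have r2 : 0 < r n / 2 by rewrite divr_gt0.
  have e0 : 0 < of_real k (r n / 2) :> K.
    by rewrite -(of_real0 R k) ltr_of_real.
  have /cauchyP/(_ _ e0)[x Fx] := Fc.
  have [v hv] := to_completion_dense x r2.
  exists v; apply: filterS Fx => y /=.
  rewrite -ball_normE /= -rnormE ltr_of_real => xy.
  rewrite -[_ - y](subrKA x) (le_lt_trans (rnormD _ _))//.
  by rewrite [r n]splitr ltrD.
have [v hv] := choice approx.
have vv m n : p (v m - v n) < r m + r n.
  have [y [/= ym yn]] := filter_ex (filterI (hv m) (hv n)).
  rewrite -rnorm_to_completion linearB /= -(subrKA y).
  rewrite (le_lt_trans (rnormD _ _))// ltrD//.
  by rewrite -opprB /rnorm normrN.
have small (e : R) : 0 < e -> exists n, r n < e.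
  by move=> /ltr_add_invr[n]; rewrite add0r; exists n.
have vC : v \in cauchy_pred p.
  apply/asboolP => e e0; have [N hN] := small _ (divr_gt0 e0 (ltr0n R 2)).
  exists N => m n Nm Nn; apply: lt_trans (vv m n) _.
  by have := r_le _ _ Nm; have := r_le _ _ Nn; lra.
pose f : C := exist _ v vC.
have vf n : rnorm (to_completion (v n) - \pi_completion f) <= r n + r n.
  apply: cvgr_to_le (dist_to_completion _ _) _.
  by exists n => // m /= nm; have := vv n m; have := r_le _ _ nm; lra.
apply/cvg_ex; exists (\pi_completion f).
apply/cvgrPdist_lt => e e0.
have e3 : 0 < re_part e / 3 by rewrite divr_gt0// re_part_gt0.
have [n hn] := small _ e3.
apply: filterS (hv n) => y /= hy.
rewrite -rnormE -[e]re_partK ?ltW// ltr_of_real.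
rewrite -(subrKA (to_completion (v n))) (le_lt_trans (rnormD _ _))//.
have : rnorm (\pi_completion f - to_completion (v n)) <= r n + r n.
  by rewrite -opprB /rnorm normrN; exact: vf.
by lra.
Qed.

HB.instance Definition _ :=
  Uniform_isComplete.Build completion completion_complete.

End Completion.

Section Tensor.
Variables (K : numFieldType) (X Y : lmodType K).
Local Notation form := {bilinear X -> Y -> K | *%R & *%R}.

Definition eval_form (x : X) (y : Y) : form -> K := fun B => B x y.

(* The algebraic tensor product is realized as the space of linear functionals
   on bilinear forms that is spanned by the evaluations B |-> B x y. *)
Definition tensor_pred : {pred (form -> K)} :=
  [pred w : form -> K |
    `[< exists s : seq (X * Y), w = \sum_(q <- s) eval_form q.1 q.2 >]].

Lemma tensor_pred_submod : submod_closed tensor_pred.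
Proof.
split=> [|a v w /asboolP[s ->] /asboolP[t ->]]; apply/asboolP.
  by exists [::]; rewrite big_nil.
exists ([seq (a *: q.1, q.2) | q <- s] ++ t).
rewrite big_cat big_map scaler_sumr; congr (_ + _).
by apply: eq_bigr => q _; apply/funext => B; rewrite /eval_form/= linearZl_LR.
Qed.

HB.instance Definition _ :=
  GRing.isSubmodClosed.Build K (form -> K) tensor_pred tensor_pred_submod.

Definition tensor := {w : form -> K | w \in tensor_pred}.
HB.instance Definition _ := SubChoice.on tensor.
HB.instance Definition _ := [SubChoice_isSubLmodule of tensor by <:].

Lemma eval_form_tensor x y : eval_form x y \in tensor_pred.
Proof. by apply/asboolP; exists [:: (x, y)]; rewrite big_seq1. Qed.

Definition tens (x : X) (y : Y) : tensor :=
  exist _ (eval_form x y) (eval_form_tensor x y).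

Definition tensor_sum (s : seq (X * Y)) : tensor := \sum_(q <- s) tens q.1 q.2.

Lemma val_tensor_sum s B : val (tensor_sum s) B = \sum_(q <- s) B q.1 q.2.
Proof.
rewrite /tensor_sum raddf_sum /=.
by elim: s => [|q s IH]; rewrite ?big_nil// !big_cons -IH.
Qed.

Lemma tensor_sumP (w : tensor) : exists s, w = tensor_sum s.
Proof.
have /asboolP[s ws] := valP w; exists s; apply: val_inj.
by rewrite ws /tensor_sum raddf_sum.
Qed.

Lemma tensor_sum_cat s t : tensor_sum (s ++ t) = tensor_sum s + tensor_sum t.
Proof. exact: big_cat. Qed.

Lemma tensor_sumZ a s :
  tensor_sum [seq (a *: q.1, q.2) | q <- s] = a *: tensor_sum s.
Proof.
rewrite /tensor_sum big_map scaler_sumr; apply: eq_bigr => q _.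
by apply/val_inj/funext => B; rewrite /= /eval_form linearZl_LR.
Qed.

Definition form_mul (f : {scalar X}) (g : {scalar Y}) (x : X) (y : Y) : K :=
  f x * g y.

Lemma form_mul_bilinear f g : bilinear_for *%R *%R (form_mul f g).
Proof.
split=> [y a u v|x a u v]; rewrite /form_mul linearP /=.
  by rewrite mulrDl mulrA.
by rewrite mulrDr mulrCA.
Qed.

HB.instance Definition _ f g :=
  bilinear_isBilinear.Build K X Y K *%R *%R (form_mul f g)
    (form_mul_bilinear f g).

End Tensor.

Definition dual_ball (R : realType) (k : field_kind)
    (X : normedModType (base_field R k)) : set {scalar X} :=
  [set f : {scalar X} | forall x, `|f x| <= `|x| ].

Section TensorNorms.
Variables (R : realType) (k : field_kind).
Local Notation K := (base_field R k).
Variables X Y : normedModType K.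
Implicit Types (w : tensor X Y) (s : seq (X * Y)).

(* The value of the inner sum does not depend on the representation s of w;
   see [inj_normE]. *)
Definition inj_norm w : R :=
  sup [set r | exists (s : seq (X * Y)) (f : {scalar X}) (g : {scalar Y}),
         [/\ w = tensor_sum s, dual_ball f, dual_ball g &
             r = rnorm (\sum_(q <- s) f q.1 * g q.2)]].

Definition proj_norm w : R :=
  inf [set r | exists2 s : seq (X * Y), w = tensor_sum s &
         r = \sum_(q <- s) rnorm q.1 * rnorm q.2].

Lemma inj_normE w (s0 : seq (X * Y)) : w = tensor_sum s0 ->
  inj_norm w = sup [set r | exists (f : {scalar X}) (g : {scalar Y}),
         [/\ dual_ball f, dual_ball g &
             r = rnorm (\sum_(q <- s0) f q.1 * g q.2)]].
Proof.
move=> ws0; congr sup; apply/seteqP; split=> r /=.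
  move=> [s [f [g [ws fX gY ->]]]]; exists f, g; split=> //; congr rnorm.
  by rewrite -!(val_tensor_sum _ (form_mul f g)) -ws ws0.
by move=> [f [g [fX gY ->]]]; exists s0, f, g.
Qed.

Let zero_dual (Z : normedModType K) : dual_ball (\0 : {scalar Z}).
Proof. by move=> x; rewrite normr0. Qed.

Lemma inj_bounded s (f : {scalar X}) (g : {scalar Y}) :
  dual_ball f -> dual_ball g ->
  rnorm (\sum_(q <- s) f q.1 * g q.2) <= \sum_(q <- s) rnorm q.1 * rnorm q.2.
Proof.
move=> fX gY; elim: s => [|q s IH]; first by rewrite !big_nil rnorm0.
rewrite !big_cons (le_trans (rnormD _ _))// lerD// rnormM.
by rewrite ler_pM ?rnorm_ge0// ler_re_part.
Qed.

Let inj_set s := [set r | exists (f : {scalar X}) (g : {scalar Y}),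
  [/\ dual_ball f, dual_ball g & r = rnorm (\sum_(q <- s) f q.1 * g q.2)]].

Let inj_has_sup s : has_sup (inj_set s).
Proof.
split; first by exists (rnorm (\sum_(q <- s) (\0 : {scalar X}) q.1 *
    (\0 : {scalar Y}) q.2)), \0, \0.
by exists (\sum_(q <- s) rnorm q.1 * rnorm q.2) => r [f [g [? ? ->]]];
  exact: inj_bounded.
Qed.

Lemma inj_normD v w : inj_norm (v + w) <= inj_norm v + inj_norm w.
Proof.
have [s vs] := tensor_sumP v; have [t wt] := tensor_sumP w.
have vw : v + w = tensor_sum (s ++ t) by rewrite tensor_sum_cat vs wt.
rewrite (inj_normE vs) (inj_normE wt) (inj_normE vw).
apply: (ge_sup (inj_has_sup (s ++ t)).1) => r [f [g [fX gY ->]]].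
rewrite big_cat (le_trans (rnormD _ _))// lerD//.
  by apply: (sup_ubound (inj_has_sup s).2); exists f, g.
by apply: (sup_ubound (inj_has_sup t).2); exists f, g.
Qed.

Let inj_norm_scale_le a w : inj_norm (a *: w) <= rnorm a * inj_norm w.
Proof.
have [s ws] := tensor_sumP w.
have aws : a *: w = tensor_sum [seq (a *: q.1, q.2) | q <- s].
  by rewrite tensor_sumZ ws.
rewrite (inj_normE ws) (inj_normE aws).
apply: (ge_sup (inj_has_sup _).1) => r [f [g [fX gY ->]]].
rewrite big_map (eq_bigr (fun q => a * (f q.1 * g q.2))); last first.
  by move=> q _ /=; rewrite linearZ /= mulrA.
rewrite -mulr_sumr rnormM ler_wpM2l ?rnorm_ge0//.
by apply: (sup_ubound (inj_has_sup s).2); exists f, g.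
Qed.

Let scale_eq (N : tensor X Y -> R) :
  (forall a w, N (a *: w) <= rnorm a * N w) -> (forall w, 0 <= N w) ->
  forall a w, N (a *: w) = rnorm a * N w.
Proof.
move=> N_le N_ge0 a w; apply/le_anti; rewrite N_le /=.
have [->|a0] := eqVneq a 0; first by rewrite rnorm0 mul0r N_ge0.
have -> : N w = N (a^-1 *: (a *: w)) by rewrite scalerA mulVf// scale1r.
rewrite (le_trans (ler_wpM2l (rnorm_ge0 _) (N_le _ _)))//.
by rewrite mulrA -rnormM divff// /rnorm normr1 re_part1 mul1r.
Qed.

Let inj_norm_ge0 w : 0 <= inj_norm w.
Proof.
have [s ws] := tensor_sumP w; rewrite (inj_normE ws).
apply: le_trans (rnorm_ge0 _) _; apply: (sup_ubound (inj_has_sup s).2).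
by exists \0, \0.
Qed.

Lemma inj_normZ a w : inj_norm (a *: w) = rnorm a * inj_norm w.
Proof. exact: scale_eq. Qed.

Let proj_sum s : R := \sum_(q <- s) rnorm q.1 * rnorm q.2.

Let proj_sum_ge0 s : 0 <= proj_sum s.
Proof. by apply: sumr_ge0 => q _; rewrite mulr_ge0 ?rnorm_ge0. Qed.

Let proj_has_inf w :
  has_inf [set r | exists2 s, w = tensor_sum s & r = proj_sum s].
Proof.
have [s ws] := tensor_sumP w; split; first by exists (proj_sum s), s.
by exists 0 => r [t _ ->].
Qed.

Let proj_norm_le s : proj_norm (tensor_sum s) <= proj_sum s.
Proof. by apply: (ge_inf (proj_has_inf _).2); exists s. Qed.

Let proj_normP w (e : R) : 0 < e ->
  exists2 s, w = tensor_sum s & proj_sum s < proj_norm w + e.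
Proof.
move=> e0; have [r [s ws ->] rs] := inf_adherent e0 (proj_has_inf w).
by exists s.
Qed.

Let proj_norm_ge0 w : 0 <= proj_norm w.
Proof. by apply: (lb_le_inf (proj_has_inf w).1) => r [s _ ->]. Qed.

Lemma proj_normD v w : proj_norm (v + w) <= proj_norm v + proj_norm w.
Proof.
apply/ler_addgt0Pr => e e0; have e2 := divr_gt0 e0 (ltr0n R 2).
have [s -> hs] := proj_normP v e2; have [t -> ht] := proj_normP w e2.
have := proj_norm_le (s ++ t); rewrite tensor_sum_cat /proj_sum big_cat /=.
rewrite -!/(proj_sum _); lra.
Qed.

Let proj_norm_scale_le a w : proj_norm (a *: w) <= rnorm a * proj_norm w.
Proof.
have [s0 ws0] := tensor_sumP w.
have le_s s : w = tensor_sum s -> proj_norm (a *: w) <= rnorm a * proj_sum s.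
  move=> ws; have := proj_norm_le [seq (a *: q.1, q.2) | q <- s].
  rewrite tensor_sumZ -ws /proj_sum big_map mulr_sumr => /le_trans; apply.
  by apply: ler_sum => q _ /=; rewrite rnormZ mulrA.
have [a0|a0] := eqVneq (rnorm a) 0.
  by have := le_s _ ws0; rewrite a0 !mul0r.
have {}a0 : 0 < rnorm a by rewrite lt_def a0 rnorm_ge0.
rewrite -ler_pdivrMl//; apply: (lb_le_inf (proj_has_inf w).1) => r [s ws ->].
by rewrite ler_pdivrMl// le_s.
Qed.

Lemma proj_normZ a w : proj_norm (a *: w) = rnorm a * proj_norm w.
Proof. exact: scale_eq. Qed.

Definition inj_seminorm := Seminorm inj_normD inj_normZ.
Definition proj_seminorm := Seminorm proj_normD proj_normZ.

Definition inj_tensor := completion inj_seminorm.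
Definition proj_tensor := completion proj_seminorm.

HB.instance Definition _ := CompleteNormedModule.on inj_tensor.
HB.instance Definition _ := CompleteNormedModule.on proj_tensor.

End TensorNorms.

(* Main.v *)
From HB Require Import structures.
Require Import Defs.
From mathcomp Require Import all_boot all_order all_algebra.
From mathcomp Require Import all_classical all_reals all_analysis.
From mathcomp Require Import perm complex ring lra.

(** The constant [CNJ] is at most 2 in every normed space, by the triangle
    inequality and the arithmetic-quadratic mean inequality.  It equals 2 as
    soon as the unit ball contains, for each small h, two vectors u and v with
    both |u + v| and |u - v| at least 2 - 8 h ([CNJ_eq2]).  The proof exhibits
    such almost square pairs inside the algebraic tensor product, whose
    elements keep their norm in the completion.

    The source of these pairs is a two-vector form of the Dvoretzky-Rogers
    lemma ([dvoretzky_rogers]): given s < 1, every norm on K^n with n large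
    admits vectors x and y of norm greater than s that satisfy the upper
    Hilbertian estimate |a x + b y|^2 <= |a|^2 + |b|^2.  For its proof, take a
    matrix T that maps the Euclidean ball into the unit ball and whose
    determinant is at least half of the supremum.  If, after composition with
    T, the norm were at most s times the Euclidean norm on the orthogonal of
    some unit vector x, then one could stretch that orthogonal by a factor
    b > 1 and shrink the line of x by 1 - b s while staying contractive; this
    multiplies the determinant by (1 - b s) b^(n-1), which exceeds 2 for n
    large.  So the orthogonal of every unit vector contains a unit vector of
    norm greater than s, and using this twice yields an orthonormal pair.

    The lemma is applied to an infinite-dimensional space X and to its dual,
    through arbitrarily long biorthogonal systems, which the Hahn-Banach
    theorem provides ([biorthogonal_system]).  Hahn-Banach itself is obtained
    from minimal sublinear functionals, so that no extension of functionals
    from subspaces has to be considered.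

    - Injective norm.  Choose x, x' in X and y, y' in Y as in the lemma.  For
      functionals f and g in the dual balls, (f x, f x') and (g y, g y') lie
      in the Euclidean unit ball, so by the Cauchy-Schwarz inequality the
      tensors x (x) y + x' (x) y' and x (x) y - x' (x) y' have norm at most 1,
      while their sum and difference are 2 x (x) y and 2 x' (x) y', of norm at
      least 2 s^2.
    - Projective norm.  Choose f, f' in the dual of X and g, g' in the dual of
      Y as in the lemma, and vectors x, x', y, y' of the unit balls where they
      almost attain their norms.  The bilinear forms f (x) g + f' (x) g' and
      f (x) g - f' (x) g' have norm at most 1, again by Cauchy-Schwarz.  As
      |f x|^2 + |f' x|^2 <= 1 and f x is close to 1, f' x is close to 0, and
      likewise for the other off-diagonal values.  Hence these two forms take
      values close to 2 on x (x) y + x' (x) y' and x (x) y - x' (x) y', whose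
      projective norms are therefore close to 2, although x (x) y and
      x' (x) y' have norm at most 1. *)

Set Implicit Arguments.
Unset Strict Implicit.
Unset Printing Implicit Defensive.

Import Order.TTheory GRing.Theory Num.Theory.
Import numFieldNormedType.Exports.

Local Open Scope classical_set_scope.
Local Open Scope ring_scope.

(** * Minimal sublinear functionals *)
Section Sublinear.
Variables (R : realType) (k : field_kind) (V : lmodType (base_field R k)).
Implicit Types (p q : V -> R) (x y z : V).
Local Notation rscale t x := (of_real k t *: x).

Lemma of_real1 : of_real k 1 = 1 :> base_field R k.
Proof. by case: k. Qed.

Definition sublinear q : Prop :=
  (forall x y, q (x + y) <= q x + q y) /\
  (forall (t : R) x, 0 <= t -> q (rscale t x) = t * q x).

Lemma sublinear0 q : sublinear q -> q 0 = 0.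
Proof.
by move=> [_ qZ]; have := qZ 0 0 (lexx 0); rewrite of_real0 scale0r mul0r.
Qed.

Lemma sublinear_opp_ge q x : sublinear q -> - q (- x) <= q x.
Proof.
move=> sq; rewrite -subr_ge0 opprK.
by have := sq.1 x (- x); rewrite subrr (sublinear0 sq).
Qed.

(** Infima arise twice below: over the amount t by which a functional is
    tilted, and over a chain of functionals.  Both families are directed enough
    for the hypotheses here, which ask only that sums and multiples of values
    be dominated by some member of the family. *)
Lemma inf_sublinear (I : Type) (D : set I) (F : I -> V -> R) (b : V -> R) :
  (forall i x, D i -> b x <= F i x) ->
  (forall i j x y, D i -> D j ->
    exists2 l, D l & F l (x + y) <= F i x + F j y) ->
  (forall i t x, D i -> 0 < t ->
    exists2 l, D l & F l (rscale t x) <= t * F i x) ->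
  (forall i, D i -> F i 0 = 0) -> D !=set0 ->
  sublinear (fun x => inf [set F i x | i in D]).
Proof.
move=> bF FD FZ F0 [i0 Di0]; pose q x := inf [set F i x | i in D].
have qle i x : D i -> q x <= F i x.
  move=> Di; apply: ge_inf; last by exists i.
  by exists (b x) => _ [j Dj <-]; exact: bF.
have le_q c x : (forall i, D i -> c <= F i x) -> c <= q x.
  move=> h; apply: lb_le_inf; first by exists (F i0 x), i0.
  by move=> _ [j Dj <-]; exact: h.
have q0 : q 0 = 0.
  apply/le_anti/andP; split; first by rewrite -(F0 _ Di0); exact: qle.
  by apply: (le_q) => i Di; rewrite F0.
have qZ_le t x : 0 < t -> q (rscale t x) <= t * q x.
  move=> t0; rewrite -ler_pdivrMl//; apply: (le_q) => i Di.
  have [l Dl Fl] := FZ i t x Di t0.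
  by rewrite ler_pdivrMl//; exact: le_trans (qle _ _ Dl) Fl.
change (sublinear q); split=> [x y|t x].
  rewrite -lerBlDr; apply: (le_q) => i Di; rewrite lerBlDr -lerBlDl.
  apply: (le_q) => j Dj; rewrite lerBlDl.
  by have [l Dl Fl] := FD i j x y Di Dj; exact: le_trans (qle _ _ Dl) Fl.
rewrite le_eqVlt => /predU1P[<-|t0]; first by rewrite of_real0 scale0r mul0r.
apply/le_anti; rewrite qZ_le//= -ler_pdivlMl//.
have := qZ_le t^-1 (rscale t x).
rewrite scalerA -of_realM mulVf ?gt_eqF// of_real1 scale1r; apply.
by rewrite invr_gt0.
Qed.

(** The largest sublinear functional below [q] that takes the value [- q x] at
    [- x]: along the line of [x] it agrees with a linear functional. *)
Definition tilt q x y : R :=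
  inf [set q (y + rscale t x) - t * q x | t in [set t | 0 <= t]].

Lemma tilt_lb q x y t : sublinear q -> 0 <= t ->
  - q (- y) <= q (y + rscale t x) - t * q x.
Proof.
move=> [qD qZ] t0; have := qD (y + rscale t x) (- y).
by rewrite addrAC subrr add0r qZ// => h; lra.
Qed.

Lemma tilt_le q x y t : sublinear q -> 0 <= t ->
  tilt q x y <= q (y + rscale t x) - t * q x.
Proof.
move=> sq t0; apply: ge_inf; last by exists t.
by exists (- q (- y)) => _ [s s0 <-]; exact: tilt_lb.
Qed.

Lemma tilt_sublinear q x : sublinear q -> sublinear (tilt q x).
Proof.
move=> sq; have [qD qZ] := sq.
apply: (@inf_sublinear _ _ (fun t y => q (y + rscale t x) - t * q x)
  (fun y => - q (- y))) => [t y|t s y z|t r y|t|].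
- exact: tilt_lb.
- move=> /= t0 s0; exists (t + s); first exact: addr_ge0.
  have := qD (y + rscale t x) (z + rscale s x).
  by rewrite addrACA -scalerDl -of_realD mulrDl => h; lra.
- move=> /= t0 r0; exists (r * t); first by rewrite /= mulr_ge0// ltW.
  by rewrite of_realM -scalerA -scalerDr (qZ _ _ (ltW r0)) mulrBr mulrA.
- by move=> /= t0; rewrite add0r qZ// subrr.
- by exists 0 => /=.
Qed.

Lemma tilt_le_self q x y : sublinear q -> tilt q x y <= q y.
Proof.
move=> sq; have := tilt_le x y sq (lexx 0).
by rewrite of_real0 scale0r addr0 mul0r subr0.
Qed.

Lemma tilt_opp q x : sublinear q -> tilt q x (- x) <= - q x.
Proof.
move=> sq; have := tilt_le x (- x) sq ler01.
by rewrite of_real1 scale1r addNr (sublinear0 sq) mul1r sub0r.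
Qed.

(** Zorn's lemma applies because every sublinear functional q below p satisfies
    q x >= - q (- x) >= - p (- x), so that chains have finite pointwise
    infima. *)
Lemma minimal_sublinear p : sublinear p ->
  exists q, [/\ sublinear q, forall x, q x <= p x &
    forall q', sublinear q' -> (forall x, q' x <= q x) -> q' = q].
Proof.
move=> sp; pose P q := sublinear q /\ forall x, q x <= p x.
pose T := {q | P q}.
pose below (q1 q2 : T) : bool := `[< forall x, sval q2 x <= sval q1 x >].
have Pp : P p by split.
have [| | | |[q [sq qp]] qmin] := @Zorn T below.
- by move=> q; apply/asboolP.
- move=> q1 q2 q3 /asboolP h1 /asboolP h2; apply/asboolP => x.
  exact: le_trans (h2 x) (h1 x).
- move=> [q1 P1] [q2 P2] /asboolP /= h1 /asboolP /= h2; apply: eq_exist.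
  by apply/funext => x; apply/le_anti; rewrite h1 h2.
- move=> A Atot; have [[q0 Aq0]|A0] := pselect (A !=set0); last first.
    by exists (exist _ p Pp) => q Aq; exfalso; apply: A0; exists q.
  have lb (q : T) x : A q -> - p (- x) <= sval q x.
    move=> _; case: q => q [sq qp] /=.
    by apply: le_trans (sublinear_opp_ge x sq); rewrite lerN2.
  pose r x := inf [set sval q x | q in A].
  have rle (q : T) x : A q -> r x <= sval q x.
    move=> Aq; apply: ge_inf; last by exists q.
    by exists (- p (- x)) => _ [q' Aq' <-]; exact: lb.
  have Pr : P r.
    split; last first.
      by move=> x; apply: le_trans (rle _ x Aq0) _; case: q0 {Aq0} => q [].
    rewrite /r; apply: (@inf_sublinear T A (fun q : T => sval q)
      (fun x => - p (- x))).
    + by move=> q x; exact: lb.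
    + move=> q1 q2 x y A1 A2; case: (Atot _ _ A1 A2) => /asboolP h.
        exists q2 => //; case: q2 A2 h => q2 [[q2D _] _] /= _ h.
        by apply: le_trans (q2D _ _) _; rewrite lerD2r.
      exists q1 => //; case: q1 A1 h => q1 [[q1D _] _] /= _ h.
      by apply: le_trans (q1D _ _) _; rewrite lerD2l.
    + move=> q t x Aq t0; exists q => //.
      by case: q Aq => q [[_ qZ] _] /= _; rewrite qZ// ltW.
    + by case=> q [sq qp] /= _; exact: sublinear0.
    + by exists q0.
  by exists (exist _ r Pr) => q Aq; apply/asboolP => x /=; exact: rle.
exists q; split=> // q' sq' q'q.
have Pq' : P q' by split=> // x; exact: le_trans (q'q x) (qp x).
by have /(congr1 sval) := qmin (exist _ q' Pq') (asboolT q'q).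
Qed.

(** A minimal sublinear functional equals each of its tilts, hence is odd, hence
    linear.  Starting from the tilt of [p] at [x0] rather than from [p] itself
    forces the value [p x0] at [x0]. *)
Lemma real_hahn_banach p x0 : sublinear p ->
  exists q : V -> R, [/\ forall x y, q (x + y) = q x + q y,
    forall (t : R) x, q (rscale t x) = t * q x,
    forall x, q x <= p x & q x0 = p x0].
Proof.
move=> sp; have [q [sq qle qmin]] := minimal_sublinear (tilt_sublinear x0 sp).
have qN x : q (- x) = - q x.
  apply/le_anti/andP; split.
    rewrite -{1}(qmin (tilt q x)); [exact: tilt_opp|exact: tilt_sublinear|].
    by move=> y; exact: tilt_le_self.
  by have := sublinear_opp_ge (- x) sq; rewrite opprK.
have qle_p x : q x <= p x by exact: le_trans (qle x) (tilt_le_self _ _ sp).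
have [qD qZ] := sq; exists q; split=> // [x y|t x|].
- apply/le_anti; rewrite qD/=; have := qD (- x) (- y).
  by rewrite -opprD !qN => h; lra.
- have [t0|/ltW t0] := leP 0 t; first exact: qZ.
  have -> : rscale t x = - rscale (- t) x.
    apply/eqP; rewrite -addr_eq0 -scalerDl -of_realD subrr.
    by rewrite of_real0 scale0r.
  by rewrite qN qZ ?oppr_ge0//; lra.
- apply/le_anti; rewrite qle_p/=.
  have := le_trans (qle (- x0)) (tilt_opp x0 sp).
  by rewrite qN lerN2.
Qed.

End Sublinear.

(** * Conjugation in the base field *)
Lemma rnorm_complex (R : realType) (a : base_field R complex_kind) :
  rnorm a = Num.sqrt (complex.Re a ^+ 2 + complex.Im a ^+ 2).
Proof. exact: (congr1 (@complex.Re R) (normc_def a)). Qed.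

Section Conjugation.
Variables (R : realType) (k : field_kind).
Local Notation K := (base_field R k).
Implicit Types (a b : K) (r s : R).

Definition base_conj : K -> K :=
  match k return base_field R k -> base_field R k with
  | real_kind => id
  | complex_kind => @conjc R
  end.

Lemma base_conj_is_zmod_morphism : zmod_morphism base_conj.
Proof. by rewrite /base_conj; case: k => //= a b; rewrite raddfB. Qed.

Lemma base_conj_is_monoid_morphism : monoid_morphism base_conj.
Proof.
rewrite /base_conj; case: k => //=; split => [|a b]; first exact: rmorph1.
exact: rmorphM.
Qed.

HB.instance Definition _ :=
  GRing.isZmodMorphism.Build K K base_conj base_conj_is_zmod_morphism.
HB.instance Definition _ :=
  GRing.isMonoidMorphism.Build K K base_conj base_conj_is_monoid_morphism.

Lemma of_realB r s : of_real k (r - s) = of_real k r - of_real k s.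
Proof. by apply/eqP; rewrite eq_sym subr_eq -of_realD subrK. Qed.

Lemma of_realX r m : of_real k (r ^+ m) = of_real k r ^+ m.
Proof.
elim: m => [|m IH]; first by rewrite !expr0 of_real1.
by rewrite exprS of_realM IH -exprS.
Qed.

Lemma of_real_inj : injective (@of_real R k).
Proof. exact: can_inj (@of_realK R k). Qed.

Lemma rnorm1 : rnorm (1 : K) = 1.
Proof. by rewrite /rnorm normr1 re_part1. Qed.

Lemma rnormN (X : normedZmodType K) (x : X) : rnorm (- x) = rnorm x.
Proof. by rewrite /rnorm normrN. Qed.

Lemma rnorm_of_real r : rnorm (of_real k r) = `|r|.
Proof.
by case: k => //; rewrite rnorm_complex /= expr0n addr0 sqrtr_sqr.
Qed.

Lemma rnorm_eq0 (X : normedZmodType K) (x : X) : rnorm x = 0 -> x = 0.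
Proof.
by move=> /(congr1 (@of_real R k)); rewrite rnormE of_real0 => /normr0_eq0.
Qed.

Lemma base_conjM a : base_conj a * a = of_real k (rnorm a ^+ 2).
Proof.
rewrite /base_conj; case: k a => a.
  by rewrite /rnorm /= real_normK ?num_real// expr2.
rewrite rnorm_complex sqr_sqrtr ?addr_ge0 ?sqr_ge0//.
by case: a => x y /=; congr Complex; ring.
Qed.

Lemma rnorm_conj a : rnorm (base_conj a) = rnorm a.
Proof.
have [->|a0] := eqVneq a 0; first by rewrite rmorph0.
have ra : rnorm a != 0 by apply: contra_neq a0; exact: rnorm_eq0.
apply: (mulIf ra); rewrite -rnormM base_conjM rnorm_of_real.
by rewrite ger0_norm ?sqr_ge0.
Qed.

Lemma base_conjK : involutive base_conj.
Proof. by move=> a; rewrite /base_conj; case: k a => // a; exact: conjcK. Qed.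

Lemma re_part_le_rnorm a : re_part a <= rnorm a.
Proof.
case: k a => a; first exact: ler_norm.
rewrite rnorm_complex; apply: le_trans (ler_norm _) _.
by rewrite -sqrtr_sqr ler_wsqrtr// lerDl sqr_ge0.
Qed.

Lemma rnorm_sum (X : normedZmodType K) (I : finType) (F : I -> X) :
  rnorm (\sum_i F i) <= \sum_i rnorm (F i).
Proof.
elim/big_ind2: _ => [|u v u' v' h h'|//]; first by rewrite rnorm0.
by apply: le_trans (rnormD _ _) _; exact: lerD.
Qed.

End Conjugation.

(** * The Hahn-Banach theorem over both fields *)
Section HahnBanach.
Variables (R : realType) (k : field_kind).
Local Notation K := (base_field R k).

Lemma scalar_of_function (F : fieldType) (X : lmodType F) (q : X -> F) :
  (forall x y, q (x + y) = q x + q y) -> (forall a x, q (a *: x) = a * q x) ->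
  exists f : {scalar X}, forall x, f x = q x.
Proof.
move=> qD qZ; have q_lin : linear_for *%R q by move=> a x y; rewrite qD qZ.
pose L := GRing.isLinear.Build F X F *%R q q_lin.
by exists (HB.pack_for {scalar X} q L).
Qed.

(** A complex-linear functional is determined by its real part q, through
    f x = q x - i q (i x). *)
Lemma scalar_of_re_part (X : lmodType K) (q : X -> R) :
  (forall x y, q (x + y) = q x + q y) ->
  (forall (t : R) x, q (of_real k t *: x) = t * q x) ->
  exists f : {scalar X}, forall x, re_part (f x) = q x.
Proof.
case: k X q => X q qD qZ; first exact: scalar_of_function qD qZ.
pose i : R[i] := Complex 0 1.
have qN x : q (- x) = - q x.
  have := qD x (- x); rewrite subrr; have := qZ 0 0.
  by rewrite scaler0 mul0r => -> h; lra.
have qC (u v : R) (x : X) : q (Complex u v *: x) = u * q x + v * q (i *: x).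
  have -> : Complex u v = Complex u 0 + Complex v 0 * i.
    by congr Complex; ring.
  by rewrite scalerDl qD -scalerA !qZ.
have [] := @scalar_of_function _ X (fun x => Complex (q x) (- q (i *: x))).
- by move=> x y; rewrite scalerDr !qD opprD.
- move=> [u v] x; rewrite scalerA.
  have -> : i * Complex u v = Complex (- v) u by congr Complex; ring.
  by rewrite (qC u v) (qC (- v) u); congr Complex; ring.
by move=> f fE; exists f => x; rewrite fE.
Qed.

(** The bound on the real part of f extends to f: replacing x by
    conj (f x) x makes the value of f real, equal to |f x|^2. *)
Theorem hahn_banach (X : normedModType K) (x0 : X) :
  exists2 f : {scalar X}, dual_ball f & rnorm (f x0) = rnorm x0.
Proof.
have sn : sublinear (fun x : X => rnorm x).
  split=> [x y|t x t0]; first exact: rnormD.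
  by rewrite rnormZ rnorm_of_real ger0_norm.
have [q [qD qZ qle qx0]] := real_hahn_banach x0 sn.
have [f fq] := scalar_of_re_part qD qZ.
have f_le x : rnorm (f x) <= rnorm x.
  have [->|fx0] := eqVneq (rnorm (f x)) 0; first exact: rnorm_ge0.
  have {}fx0 : 0 < rnorm (f x) by rewrite lt_def fx0 rnorm_ge0.
  rewrite -(ler_pM2l fx0) -expr2 -[X in X <= _](@of_realK _ k).
  rewrite -base_conjM -[_ * _]linearZ fq.
  by apply: le_trans (qle _) _; rewrite rnormZ rnorm_conj.
exists f; first by move=> x; rewrite -!rnormE ler_of_real.
by apply/le_anti; rewrite f_le -qx0 -fq re_part_le_rnorm.
Qed.

End HahnBanach.

(** * Euclidean structure of column vectors *)
Section Euclidean.
Variables (R : realType) (k : field_kind).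
Local Notation K := (base_field R k).

Section Dimension.
Variable n : nat.
Implicit Types (c x y : 'cV[K]_n) (a b : K).

Definition nsq c : R := \sum_i rnorm (c i 0) ^+ 2.

Definition adjoint c : 'rV[K]_n := (map_mx (@base_conj R k) c)^T.

Definition dot x y : K := (adjoint x *m y) 0 0.

Lemma adjointD x y : adjoint (x + y) = adjoint x + adjoint y.
Proof. by rewrite /adjoint map_mxD linearD. Qed.

Lemma dotDr x y z : dot x (y + z) = dot x y + dot x z.
Proof. by rewrite /dot mulmxDr mxE. Qed.

Lemma dotDl x y z : dot (x + y) z = dot x z + dot y z.
Proof. by rewrite /dot adjointD mulmxDl mxE. Qed.

Lemma dotZr a x y : dot x (a *: y) = a * dot x y.
Proof. by rewrite /dot -scalemxAr mxE. Qed.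

Lemma dot_conj x y : base_conj (dot x y) = dot y x.
Proof.
rewrite /dot !mxE rmorph_sum; apply: eq_bigr => i _.
by rewrite !mxE rmorphM /= mulrC base_conjK.
Qed.

Lemma dot_self c : dot c c = of_real k (nsq c).
Proof.
rewrite /nsq (big_morph _ (@of_realD R k) (of_real0 R k)) /dot mxE.
by apply: eq_bigr => i _; rewrite !mxE base_conjM.
Qed.

Lemma nsq_ge0 c : 0 <= nsq c.
Proof. by apply: sumr_ge0 => i _; exact: sqr_ge0. Qed.

Lemma nsqZ a c : nsq (a *: c) = rnorm a ^+ 2 * nsq c.
Proof.
by rewrite /nsq mulr_sumr; apply: eq_bigr => i _; rewrite mxE rnormM exprMn.
Qed.

Lemma nsqD_orth x y : dot x y = 0 -> nsq (x + y) = nsq x + nsq y.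
Proof.
move=> xy; apply: (@of_real_inj R k).
rewrite of_realD -!dot_self dotDl !dotDr -(dot_conj x y) xy rmorph0.
by rewrite addr0 add0r.
Qed.

Lemma coord_le_nsq c i : rnorm (c i 0) <= Num.sqrt (nsq c).
Proof.
rewrite -(ger0_norm (rnorm_ge0 (c i 0))) -sqrtr_sqr ler_wsqrtr// /nsq.
by rewrite (bigD1 i)//= lerDl sumr_ge0// => j _; exact: sqr_ge0.
Qed.

Lemma nsq_delta i : nsq (delta_mx i 0) = 1.
Proof.
rewrite /nsq (bigD1 i)//= big1 => [|j /negPf ji]; rewrite mxE.
  by rewrite !eqxx rnorm1 expr1n addr0.
by rewrite ji rnorm0 expr0n.
Qed.

End Dimension.

(** Both sides are the determinant of the block matrix with rows (1, - v) and
    (u, 1), computed by eliminating its lower left or its upper right block. *)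
Lemma det_add_rank1 (F : comNzRingType) n (u : 'cV[F]_n) (v : 'rV[F]_n) :
  \det (1%:M + u *m v) = 1 + (v *m u) 0 0.
Proof.
have e1 : block_mx 1%:M (- v) u (1%:M : 'M[F]_n) =
    block_mx (1%:M : 'M[F]_1) 0 u 1%:M *m block_mx 1%:M (- v) 0 (1%:M + u *m v).
  rewrite mulmx_block ?(mulmx1, mul1mx, mul0mx, mulmx0, addr0) mulmxN.
  by rewrite addrCA addNr addr0.
have e2 : block_mx 1%:M (- v) u (1%:M : 'M[F]_n) =
    block_mx (1%:M : 'M[F]_1) (- v) 0 1%:M *m block_mx (1%:M + v *m u) 0 u 1%:M.
  rewrite mulmx_block ?(mulmx1, mul1mx, mul0mx, mulmx0, add0r) mulNmx.
  by rewrite addrK.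
have := congr1 (@determinant _ _) e1; rewrite {1}e2 !det_mulmx.
rewrite !det_ublock !det_lblock !det1 !mul1r !mulr1 => <-.
by rewrite det_mx11 !mxE.
Qed.

End Euclidean.

(** * Determinant maximization and the Dvoretzky-Rogers lemma *)
Definition seminorm_comp (R : realType) (k : field_kind)
    (U V : lmodType (base_field R k)) (p : seminorm V) (f : {linear U -> V}) :
  seminorm U.
Proof.
apply: (@Seminorm _ _ U (fun u => p (f u))) => [u v|a u].
  by rewrite linearD; exact: seminormD.
by rewrite linearZ; exact: seminormZ.
Defined.

Section DvoretzkyRogers.
Variables (R : realType) (k : field_kind).
Local Notation K := (base_field R k).

Definition contractive n (p : 'cV[K]_n -> R) : Prop :=
  forall c, p c ^+ 2 <= nsq c.

(** If [q] were at most [s] times the Euclidean norm on the orthogonal of [x],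
    the map S equal to a on the line of [x] and to b on its orthogonal would be
    contractive, as soon as a + b s = 1: for c = t x + y one gets
    (a |t| + b s |y|)^2 <= a |t|^2 + b s |y|^2 <= |c|^2 by convexity of the
    square.  Its determinant a b^n exceeds 2. *)
Lemma unit_perp_large n (q : seminorm 'cV[K]_n.+1) (s : R) (x : 'cV[K]_n.+1) :
  0 < s < 1 -> 2 < (1 - s) / (1 + s) * (2 / (1 + s)) ^+ n ->
  contractive q ->
  (forall S : 'M[K]_n.+1, contractive (fun c => q (S *m c)) ->
     rnorm (\det S) <= 2) ->
  nsq x = 1 -> exists y, [/\ nsq y = 1, dot x y = 0 & s < q y].
Proof.
move=> /andP[s0 s1] n_big q_ctr q_max x1; apply: contrapT => no_y.
(* any b with 1 < b < 1 / s would do; then a = 1 - b s *)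
pose b := 2 / (1 + s); pose a := (1 - s) / (1 + s).
have s1' : 0 < 1 + s by lra.
have b0 : 0 < b by rewrite divr_gt0.
have a0 : 0 < a by rewrite divr_gt0// subr_gt0.
have ab1 : a + b * s = 1 by rewrite /a /b; field; lra.
have q_perp y : dot x y = 0 -> q y <= s * Num.sqrt (nsq y).
  move=> xy; have [y0|y0] := eqVneq (nsq y) 0.
    have := q_ctr y; rewrite y0 sqrtr0 mulr0 => h.
    have /eqP : q y ^+ 2 = 0 by apply/le_anti; rewrite h sqr_ge0.
    by rewrite sqrf_eq0 => /eqP ->.
  have {}y0 : 0 < nsq y by rewrite lt_def y0 nsq_ge0.
  have r0 : 0 < Num.sqrt (nsq y) by rewrite sqrtr_gt0.
  rewrite leNgt; apply/negP => sy; apply: no_y.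
  have nr : rnorm (of_real k (Num.sqrt (nsq y))^-1) = (Num.sqrt (nsq y))^-1.
    by rewrite rnorm_of_real ger0_norm// invr_ge0 ltW.
  exists (of_real k (Num.sqrt (nsq y))^-1 *: y); split.
  - by rewrite nsqZ nr exprVn sqr_sqrtr ?nsq_ge0// mulVf// gt_eqF.
  - by rewrite dotZr xy mulr0.
  - by rewrite seminormZ nr mulrC ltr_pdivlMr.
(* S is a on x and b on its orthogonal, written as b times a rank-one
   perturbation of the identity so that its determinant is explicit *)
pose u : 'cV[K]_n.+1 := of_real k (a / b - 1) *: x.
pose S := of_real k b *: (1%:M + u *m adjoint x).
have Sb : contractive (fun c => q (S *m c)).
  move=> c; pose t := dot x c; pose y := c - t *: x.
  have xx : dot x x = 1 by rewrite dot_self x1 of_real1.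
  have xy : dot x y = 0.
    by rewrite /y -scaleN1r dotDr !dotZr xx mulr1 mulN1r subrr.
  have cE : c = t *: x + y by rewrite /y addrC subrK.
  have nc : nsq c = rnorm t ^+ 2 + nsq y.
    rewrite cE nsqD_orth; first by rewrite nsqZ x1 mulr1.
    by rewrite -(dot_conj y) dotZr -(dot_conj x) xy rmorph0 mulr0 rmorph0.
  have Sc : S *m c = (of_real k a * t) *: x + of_real k b *: y.
    have -> : S *m c = of_real k b *: (c + t *: u).
      rewrite /S -scalemxAl mulmxDl mul1mx -mulmxA.
      by rewrite [adjoint x *m c]mx11_scalar mul_mx_scalar.
    rewrite {1}cE /u addrAC scalerDr scalerA -scalerDl scalerA.
    congr (_ *: _ + _).
    rewrite of_realB of_real1 mulrBr mulr1 addrC subrK mulrCA -of_realM.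
    by rewrite mulrCA divff ?gt_eqF// mulr1 mulrC.
  have bound : q (S *m c) <= a * rnorm t + b * (s * Num.sqrt (nsq y)).
    rewrite Sc (le_trans (seminormD _ _ _))// !seminormZ rnormM !rnorm_of_real.
    rewrite !ger0_norm ?(ltW a0) ?(ltW b0)// lerD//; last first.
      by rewrite ler_pM2l// q_perp.
    have qx : q x <= 1.
      have := q_ctr x; rewrite x1 -{1}(expr1n R 2) ler_pXn2r// nnegrE//.
      exact: seminorm_ge0.
    by rewrite -{2}[rnorm t]mulr1 mulrA ler_wpM2l// mulr_ge0 ?rnorm_ge0 ?ltW.
  rewrite nc -(sqr_sqrtr (nsq_ge0 y)).
  have := rnorm_ge0 t; have := sqrtr_ge0 (nsq y).
  have := seminorm_ge0 q (S *m c).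
  move: bound; move: (q _) (Num.sqrt _) (rnorm t) => Q m r bound Q0 m0 r0.
  have aE : a = 1 - b * s by lra.
  have w0 : 0 <= b * s by rewrite mulr_ge0// ltW.
  move: bound; rewrite mulrA; move: (b * s) aE w0 => w aE w0 bound.
  have : Q ^+ 2 <= (a * r + w * m) ^+ 2.
    by rewrite ler_pXn2r// nnegrE (le_trans Q0 bound).
  have : 0 <= a * w * (r - m) ^+ 2.
    by rewrite mulr_ge0 ?sqr_ge0// mulr_ge0// ltW.
  have : 0 <= w * (r ^+ 2) by rewrite mulr_ge0// sqr_ge0.
  have : 0 <= a * (m ^+ 2) by rewrite mulr_ge0 ?sqr_ge0// ltW.
  rewrite aE; nra.
have := q_max S Sb; rewrite leNgt => /negP; apply.
rewrite /S detZ det_add_rank1 -[(_ *m _) 0 0]/(dot x u) dotZr dot_self x1.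
rewrite of_real1 mulr1 of_realB of_real1 addrC subrK.
rewrite -of_realX -of_realM rnorm_of_real ger0_norm; last first.
  by apply: mulr_ge0; [exact/exprn_ge0/ltW|exact/ltW/divr_gt0].
rewrite exprS mulrAC mulrCA divff ?gt_eqF// mulr1.
by apply: lt_le_trans n_big _; rewrite /a /b.
Qed.

Lemma orthonormal_pair_large n (q : seminorm 'cV[K]_n.+1) (s : R) :
  0 < s < 1 -> 2 < (1 - s) / (1 + s) * (2 / (1 + s)) ^+ n ->
  contractive q ->
  (forall S : 'M[K]_n.+1, contractive (fun c => q (S *m c)) ->
     rnorm (\det S) <= 2) ->
  exists x y, [/\ s < q x, s < q y &
    forall a b, q (a *: x + b *: y) ^+ 2 <= rnorm a ^+ 2 + rnorm b ^+ 2].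
Proof.
move=> s01 n_big q_ctr q_max.
have large := unit_perp_large s01 n_big q_ctr q_max.
have [x [x1 _ qx]] := large _ (nsq_delta _ _ ord0).
have [y [y1 xy qy]] := large x x1.
exists x, y; split=> // a b; apply: le_trans (q_ctr _) _.
rewrite nsqD_orth; first by rewrite !nsqZ x1 y1 !mulr1.
by rewrite dotZr -dot_conj dotZr -(dot_conj x) xy rmorph0 mulr0 rmorph0 mulr0.
Qed.

Lemma det_le n (T : 'M[K]_n) (M : R) :
  (forall i j, rnorm (T i j) <= M) -> rnorm (\det T) <= n`!%:R * M ^+ n.
Proof.
move=> TM; rewrite /determinant.
have rnorm_prod (I : finType) (F : I -> K) :
    rnorm (\prod_i F i) = \prod_i rnorm (F i).
  by rewrite (big_morph _ (@rnormM R k) (rnorm1 R k)).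
apply: le_trans (rnorm_sum _) _.
rewrite -card_Sn -sum1_card natr_sum mulr_suml; apply: ler_sum => t _.
rewrite rnormM rnorm_prod mul1r.
have -> : rnorm ((-1) ^+ t : K) = 1.
  by case: (t : bool); rewrite ?expr0 ?expr1 ?rnormN rnorm1.
rewrite mul1r -[X in M ^+ X]card_ord -prodr_const; apply: ler_prod => i _.
by rewrite rnorm_ge0 TM.
Qed.

End DvoretzkyRogers.

Section NearMaximalDeterminant.
Variables (R : realType) (k : field_kind).
Local Notation K := (base_field R k).

Lemma seminorm_sum (V : lmodType K) (p : seminorm V) (I : finType)
    (F : I -> V) :
  p (\sum_i F i) <= \sum_i p (F i).
Proof.
elim/big_ind2: _ => [|u v u' v' h h'|//]; first by rewrite seminorm0.
by apply: le_trans (seminormD _ _ _) _; exact: lerD.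
Qed.

Lemma seminorm_cV_le n (p : seminorm 'cV[K]_n) c :
  p c <= Num.sqrt (nsq c) * \sum_i p (delta_mx i 0).
Proof.
rewrite {1}(matrix_sum_delta c); apply: le_trans (seminorm_sum _ _) _.
rewrite mulr_sumr; apply: ler_sum => i _.
by rewrite big_ord1 seminormZ ler_wpM2r ?seminorm_ge0// coord_le_nsq.
Qed.

(** A determinant within a factor 2 of the supremum replaces the usual maximal
    one (John's ellipsoid), so that no compactness argument is needed: the
    bound [M] on the coordinates makes the set of determinants bounded, and a
    small multiple of the identity makes its supremum positive.  The factor 2
    is harmless because determinants are compared in a high power. *)
Lemma near_max_det n (p : seminorm 'cV[K]_n) (M : R) :
  (forall (c : 'cV[K]_n) i, rnorm (c i 0) <= M * p c) -> 0 <= M ->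
  exists2 T : 'M[K]_n, contractive (fun c => p (T *m c)) &
    forall S : 'M[K]_n, contractive (fun c => p (T *m S *m c)) ->
      rnorm (\det S) <= 2.
Proof.
move=> pM M0.
pose A := [set rnorm (\det T) |
           T in [set T : 'M[K]_n | contractive (fun c => p (T *m c))]].
have A_ub : ubound A (n`!%:R * M ^+ n).
  move=> _ [T /= T_ctr <-]; apply: det_le => i j.
  have -> : T i j = (T *m delta_mx j 0 : 'cV_n) i 0.
    by rewrite -colE mxE.
  apply: le_trans (pM _ _) _; rewrite -[X in _ <= X]mulr1 ler_wpM2l//.
  have := T_ctr (delta_mx j 0); rewrite nsq_delta -{1}(expr1n R 2).
  by rewrite ler_pXn2r// nnegrE// seminorm_ge0.
pose D := 1 + \sum_i p (delta_mx i 0).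
have D0 : 0 < D.
  by rewrite ltr_pwDl// sumr_ge0// => i _; exact: seminorm_ge0.
pose T0 : 'M[K]_n := (of_real k D^-1)%:M.
have T0_ctr : contractive (fun c => p (T0 *m c)).
  move=> c; rewrite mul_scalar_mx seminormZ rnorm_of_real.
  rewrite ger0_norm ?invr_ge0 ?(ltW D0)//.
  rewrite -[X in _ <= X]sqr_sqrtr ?nsq_ge0//.
  apply: lerXn2r; rewrite ?nnegrE ?sqrtr_ge0//.
    by rewrite mulr_ge0 ?invr_ge0 ?seminorm_ge0 ?(ltW D0).
  rewrite ler_pdivrMl// mulrC; apply: le_trans (seminorm_cV_le _ _) _.
  by rewrite ler_wpM2l ?sqrtr_ge0// /D lerDr.
have AT0 : A (rnorm (\det T0)) by exists T0.
have A_sup : has_sup A.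
  by split; [exists (rnorm (\det T0))|exists (n`!%:R * M ^+ n)].
have sup0 : 0 < sup A.
  apply: lt_le_trans (sup_ubound A_sup.2 AT0).
  rewrite det_scalar -of_realX rnorm_of_real normr_gt0.
  by rewrite expf_neq0// invr_eq0 gt_eqF.
have [_ [T /= T_ctr <-] T_max] :=
  sup_adherent (divr_gt0 sup0 (ltr0n R 2)) A_sup.
exists T => // S TS_ctr.
have : A (rnorm (\det (T *m S))) by exists (T *m S).
move=> /(sup_ubound A_sup.2); rewrite det_mulmx rnormM => TS_le.
have T_gt0 : 0 < rnorm (\det T) by lra.
by rewrite -(ler_pM2l T_gt0); lra.
Qed.

(** By Bernoulli's inequality. *)
Lemma geometric_large (a b C : R) : 0 < a -> 1 < b -> exists n, C < a * b ^+ n.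
Proof.
move=> a0 b1; have b0 : 0 < b - 1 by rewrite subr_gt0.
have bern n : n%:R * (b - 1) < b ^+ n.
  elim: n => [|n IH]; first by rewrite mul0r expr0.
  have bn : 1 <= b ^+ n by rewrite exprn_ege1// ltW.
  have : 0 <= (b ^+ n - 1) * (b - 1) by rewrite mulr_ge0 ?subr_ge0// ltW.
  rewrite exprSr -natr1; lra.
have [n Cn] : exists n : nat, C / (a * (b - 1)) < n%:R.
  by eexists; exact: truncnS_gt.
exists n; rewrite ltr_pdivrMr ?mulr_gt0// in Cn.
by apply: lt_trans Cn _; rewrite mulrCA ltr_pM2l.
Qed.

(** The dimension n depends only on [s], so that the lemma applies to the norms
    induced on biorthogonal systems of length n chosen afterwards. *)
Lemma dvoretzky_rogers (s : R) : 0 < s < 1 ->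
  exists n, forall (p : seminorm 'cV[K]_n) (M : R),
    (forall (c : 'cV[K]_n) i, rnorm (c i 0) <= M * p c) -> 0 <= M ->
    exists x y, [/\ s < p x, s < p y &
      forall a b, p (a *: x + b *: y) ^+ 2 <= rnorm a ^+ 2 + rnorm b ^+ 2].
Proof.
move=> s01; have /andP[s0 s1] := s01.
have [||n n_big] := @geometric_large ((1 - s) / (1 + s)) (2 / (1 + s)) 2.
- by rewrite divr_gt0; lra.
- by rewrite ltr_pdivlMr; lra.
exists n.+1 => p M pM M0; have [T T_ctr T_max] := near_max_det pM M0.
pose q := seminorm_comp p (mulmx T : {linear 'cV[K]_n.+1 -> 'cV[K]_n.+1}).
have [||x [y [qx qy qxy]]] := @orthonormal_pair_large _ _ n q s s01 n_big.
- exact: T_ctr.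
- by move=> S S_ctr; apply: T_max => c; rewrite -mulmxA; exact: S_ctr.
exists (T *m x), (T *m y); split=> // a b.
by have := qxy a b; rewrite /= mulmxDr -!scalemxAr.
Qed.

End NearMaximalDeterminant.

(** * Almost orthonormal pairs of vectors *)
Section Pairs.
Variables (R : realType) (k : field_kind).
Local Notation K := (base_field R k).

(** If the common kernel of f_0, ..., f_(n-1) were trivial, every v would equal
    the sum of the f_i v *: e_i and the space would be finite-dimensional.  So
    the system extends by a nonzero v of that kernel and by a functional that is
    nonzero at v, corrected to vanish at the earlier e_i. *)
Lemma biorthogonal_system (X : normedModType K) n : ~ finite_dim X ->
  exists (e : nat -> X) (f : nat -> {scalar X}) (B : R),
    [/\ 0 <= B,
      forall i j, (i < n)%N -> (j < n)%N -> f i (e j) = (i == j)%:R &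
      forall i x, (i < n)%N -> rnorm (f i x) <= B * rnorm x].
Proof.
move=> Xinf; elim: n => [|n [e [f [B [B0 fe fB]]]]].
  by exists (fun=> 0), (fun=> \0 : {scalar X}), 0.
have [v [v0 fv]] : exists v, v <> 0 /\ forall i, (i < n)%N -> f i v = 0.
  apply: contrapT => no_v; apply: Xinf; exists n, (fun i => e i) => v.
  exists (fun i => f i v); apply/eqP; rewrite -subr_eq0; apply/eqP.
  apply: contrapT => v0; apply: no_v; exists (v - \sum_(i < n) f i v *: e i).
  split=> // i i_n; rewrite linearB linear_sum (bigD1 (Ordinal i_n))//= big1.
    by rewrite addr0 linearZ /= fe// eqxx mulr1 subrr.
  move=> j /negPf ji; rewrite linearZ /= fe//.
  by rewrite eq_sym -[(_ == _)%N]/(j == Ordinal i_n) ji mulr0.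
have [g gB gv] := hahn_banach v.
have gv0 : g v != 0.
  by apply/eqP => g0; apply: v0; apply: rnorm_eq0; rewrite -gv g0 rnorm0.
pose h x := (g v)^-1 * (g x - \sum_(i < n) g (e i) * f i x).
have [||h' hE] := @scalar_of_function _ X h.
- move=> x y; rewrite /h -mulrDr linearD; congr (_ * _).
  rewrite (eq_bigr (fun i : 'I_n => g (e i) * f i x + g (e i) * f i y)).
    by rewrite big_split /= opprD addrACA.
  by move=> i _; rewrite linearD mulrDr.
- move=> a x; rewrite /h mulrCA linearZ [a * (_ - _)]mulrBr /=.
  congr (_ * (_ - _)).
  by rewrite mulr_sumr; apply: eq_bigr => i _; rewrite linearZ /= mulrCA.
pose B' := rnorm (g v)^-1 * (1 + \sum_(i < n) rnorm (g (e i)) * B).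
have B'0 : 0 <= B'.
  rewrite mulr_ge0 ?rnorm_ge0// addr_ge0// sumr_ge0// => i _.
  by rewrite mulr_ge0 ?rnorm_ge0.
have hB x : rnorm (h' x) <= B' * rnorm x.
  rewrite hE /h rnormM /B' -mulrA ler_wpM2l ?rnorm_ge0// mulrDl mul1r.
  apply: le_trans (rnormD _ _) _; rewrite rnormN lerD//.
    by apply: ler_re_part.
  apply: le_trans (rnorm_sum _) _; rewrite mulr_suml; apply: ler_sum => i _.
  by rewrite rnormM -mulrA ler_wpM2l ?rnorm_ge0// fB.
exists (fun i => if i == n then v else e i).
exists (fun i => if i == n then h' else f i).
exists (B + B'); split; first exact: addr_ge0.
- move=> i j; rewrite !ltnS [(i <= n)%N]leq_eqVlt [(j <= n)%N]leq_eqVlt.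
  case: (eqVneq i n) => [->|i_n]; case: (eqVneq j n) => [->|j_n] //=;
    rewrite ?eqxx.
  + move=> _ _; rewrite hE /h big1 ?subr0 ?mulVf// => l _.
    by rewrite fv ?mulr0.
  + move=> _ jn; rewrite hE /h (bigD1 (Ordinal jn))//= big1.
      by rewrite addr0 fe// eqxx mulr1 subrr mulr0.
    move=> l /negPf lj; rewrite fe//.
    by rewrite -[(_ == _)%N]/(l == Ordinal jn) lj mulr0.
  + by move=> i_lt _; rewrite fv// (negPf i_n).
  + by move=> i_lt j_lt; rewrite fe.
- move=> i x; rewrite ltnS leq_eqVlt mulrDl.
  case: (eqVneq i n) => [->|i_n] /= i_lt.
    by rewrite (le_trans (hB x))// lerDr mulr_ge0 ?rnorm_ge0.
  by rewrite (le_trans (fB i x i_lt))// lerDl mulr_ge0 ?rnorm_ge0.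
Qed.

(** Duality between l_2 and itself: testing the estimate on the coefficients
    conj (phi x), conj (phi y) gives N^2 <= N for the left-hand side N. *)
Lemma functional_pair_le (V : lmodType K) (p : seminorm V)
    (phi : {scalar V}) x y :
  (forall v, rnorm (phi v) <= p v) ->
  (forall a b, p (a *: x + b *: y) ^+ 2 <= rnorm a ^+ 2 + rnorm b ^+ 2) ->
  rnorm (phi x) ^+ 2 + rnorm (phi y) ^+ 2 <= 1.
Proof.
move=> phi_le pxy; set N := _ + _.
have N0 : 0 <= N by rewrite addr_ge0 ?sqr_ge0.
pose v := base_conj (phi x) *: x + base_conj (phi y) *: y.
have phiv : rnorm (phi v) = N.
  rewrite /v linearD !linearZ /= !base_conjM -of_realD rnorm_of_real.
  by rewrite ger0_norm.
have : p v ^+ 2 <= N by apply: le_trans (pxy _ _) _; rewrite !rnorm_conj.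
have : N ^+ 2 <= p v ^+ 2.
  by apply: lerXn2r; rewrite ?nnegrE ?seminorm_ge0// -phiv phi_le.
move=> h1 h2; have := le_trans h1 h2.
rewrite expr2 -[X in _ <= X -> _]mulr1.
have [->|N1] := eqVneq N 0; first by rewrite ler01.
by rewrite ler_pM2l// lt_def N1.
Qed.

Definition norm_seminorm (X : normedModType K) : seminorm X :=
  Seminorm (@rnormD R k X) (@rnormZ R k X).

(** The dual form of the estimate |a x + b y|^2 <= |a|^2 + |b|^2, which is the
    one that the injective norm uses: the weak l_2 norm of (x, y) is at
    most 1. *)
Definition weakly_2_contractive (X : normedModType K) (x y : X) : Prop :=
  forall f : {scalar X}, dual_ball f ->
    rnorm (f x) ^+ 2 + rnorm (f y) ^+ 2 <= 1.

Lemma vector_pair (X : normedModType K) (s : R) : ~ finite_dim X -> 0 < s < 1 ->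
  exists x y : X, [/\ s < rnorm x, s < rnorm y & weakly_2_contractive x y].
Proof.
move=> Xinf s01; have [n DR] := dvoretzky_rogers k s01.
have [e [f [B [B0 fe fB]]]] := biorthogonal_system n Xinf.
pose L (c : 'cV[K]_n) := \sum_(i < n) c i 0 *: e i.
have L_lin : linear L.
  move=> a c d; rewrite /L scaler_sumr -big_split; apply: eq_bigr => i _ /=.
  by rewrite !mxE scalerDl scalerA.
pose L' : {linear 'cV[K]_n -> X} :=
  HB.pack_for {linear 'cV[K]_n -> X} L
    (GRing.isLinear.Build K _ _ *:%R L L_lin).
have [||x [y [px py pxy]]] := DR (seminorm_comp (norm_seminorm X) L') B.
- move=> c i; have <- : f i (L c) = c i 0.
    rewrite /L linear_sum (bigD1 i)//= big1 => [|j /negPf ji].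
      by rewrite linearZ /= fe// eqxx mulr1 addr0.
    by rewrite linearZ /= fe// eq_sym -[(_ == _)%N]/(j == i) ji mulr0.
  exact: fB.
- exact: B0.
exists (L' x), (L' y); split=> // g gB.
apply: (functional_pair_le (p := norm_seminorm X)) => [v|a b].
  exact: ler_re_part.
have := pxy a b.
by rewrite -[seminorm_comp _ _ _]/(norm_seminorm X (L' _)) linearD !linearZ.
Qed.

End Pairs.

(** * Almost orthonormal pairs of functionals *)
Section FunctionalPairs.
Variables (R : realType) (k : field_kind).
Local Notation K := (base_field R k).

Lemma polar (X : normedModType K) (x : X) :
  exists2 u, rnorm u <= 1 & x = of_real k (rnorm x) *: u.
Proof.
have [x0|x0] := eqVneq (rnorm x) 0.
  by exists 0; [rewrite rnorm0|rewrite scaler0 (rnorm_eq0 x0)].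
exists (of_real k (rnorm x)^-1 *: x).
  by rewrite rnormZ rnorm_of_real ger0_norm ?invr_ge0 ?rnorm_ge0// mulVf.
by rewrite scalerA -of_realM divff// of_real1 scale1r.
Qed.

Lemma rotate_positive (X : normedModType K) (f : {scalar X}) (x : X) :
  exists2 y, rnorm y <= rnorm x & f y = of_real k (rnorm (f x)).
Proof.
have [fx0|fx0] := eqVneq (f x) 0.
  by exists 0; rewrite ?rnorm0 ?rnorm_ge0// linear0 fx0 rnorm0 of_real0.
exists ((of_real k (rnorm (f x)) / f x) *: x); last first.
  by rewrite linearZ /= divfK.
have r0 : rnorm (f x) != 0 by apply: contra_neq fx0; exact: rnorm_eq0.
have : rnorm (of_real k (rnorm (f x)) / f x) = 1.
  apply: (mulIf r0); rewrite -rnormM divfK// mul1r rnorm_of_real.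
  by rewrite ger0_norm// rnorm_ge0.
by rewrite rnormZ => ->; rewrite mul1r.
Qed.

(** The span of f_0, ..., f_(n-1) in the dual space is handled through
    coordinates: [dual_norm c] is the norm of the functional with coordinates
    [c]. *)
Section DualSeminorm.
Variables (X : normedModType K) (n : nat) (f : 'I_n -> {scalar X}) (B : R).
Hypothesis fB : forall i x, rnorm (f i x) <= B * rnorm x.
Hypothesis B0 : 0 <= B.
Implicit Types (c d : 'cV[K]_n) (x : X).

Definition combination c x : K := \sum_i c i 0 * f i x.

Definition dual_norm c : R :=
  sup [set rnorm (combination c x) | x in [set x | rnorm x <= 1]].

Lemma combinationD c d x :
  combination (c + d) x = combination c x + combination d x.
Proof.
by rewrite /combination -big_split; apply: eq_bigr => i _; rewrite mxE mulrDl.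
Qed.

Lemma combinationZ a c x : combination (a *: c) x = a * combination c x.
Proof.
by rewrite /combination mulr_sumr; apply: eq_bigr => i _; rewrite mxE mulrA.
Qed.

Lemma combinationDr c x y :
  combination c (x + y) = combination c x + combination c y.
Proof.
rewrite /combination -big_split; apply: eq_bigr => i _.
by rewrite linearD mulrDr.
Qed.

Lemma combinationZr c a x : combination c (a *: x) = a * combination c x.
Proof.
rewrite /combination mulr_sumr; apply: eq_bigr => i _.
by rewrite linearZ /= mulrCA.
Qed.

Lemma dual_norm_has_sup c :
  has_sup [set rnorm (combination c x) | x in [set x | rnorm x <= 1]].
Proof.
split; first by exists (rnorm (combination c 0)), 0; rewrite //= rnorm0.
exists (\sum_i rnorm (c i 0) * B) => _ [x /= x1 <-].
apply: le_trans (rnorm_sum _) _; apply: ler_sum => i _.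
rewrite rnormM ler_wpM2l ?rnorm_ge0// (le_trans (fB i x))//.
by rewrite -[X in _ <= X]mulr1 ler_wpM2l.
Qed.

Lemma combination_le_unit c x :
  rnorm x <= 1 -> rnorm (combination c x) <= dual_norm c.
Proof. by move=> x1; apply: (sup_ubound (dual_norm_has_sup c).2); exists x. Qed.

Lemma combination_le c x : rnorm (combination c x) <= dual_norm c * rnorm x.
Proof.
have [u u1 {1}->] := polar x; rewrite combinationZr rnormM rnorm_of_real.
rewrite ger0_norm ?rnorm_ge0// mulrC ler_wpM2r ?rnorm_ge0//.
exact: combination_le_unit.
Qed.

Lemma dual_norm_le c (C : R) :
  (forall x, rnorm x <= 1 -> rnorm (combination c x) <= C) -> dual_norm c <= C.
Proof.
move=> cC; apply: (ge_sup (dual_norm_has_sup c).1) => _ [x /= x1 <-].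
exact: cC.
Qed.

Lemma dual_normD c d : dual_norm (c + d) <= dual_norm c + dual_norm d.
Proof.
apply: dual_norm_le => x x1; rewrite combinationD.
by apply: le_trans (rnormD _ _) _; rewrite lerD// combination_le_unit.
Qed.

Lemma dual_normZ a c : dual_norm (a *: c) = rnorm a * dual_norm c.
Proof.
have le_scale b d : dual_norm (b *: d) <= rnorm b * dual_norm d.
  apply: dual_norm_le => x x1; rewrite combinationZ rnormM.
  by rewrite ler_wpM2l ?rnorm_ge0// combination_le_unit.
apply/le_anti; rewrite le_scale /=; have [->|a0] := eqVneq a 0.
  rewrite rnorm0 mul0r.
  have /(combination_le_unit (0 *: c)) : rnorm (0 : X) <= 1.
    by rewrite rnorm0.
  by apply: le_trans; exact: rnorm_ge0.
have {1}-> : c = a^-1 *: (a *: c) by rewrite scalerA mulVf// scale1r.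
rewrite (le_trans (ler_wpM2l (rnorm_ge0 _) (le_scale _ _)))//.
by rewrite mulrA -rnormM divff// rnorm1 mul1r.
Qed.

Definition dual_seminorm : seminorm 'cV[K]_n := Seminorm dual_normD dual_normZ.

Lemma dual_norm_attained c (s : R) : s < dual_norm c ->
  exists2 x, rnorm x <= 1 & s < rnorm (combination c x).
Proof.
move=> sc; apply: contrapT => no_x; move: sc; apply/negP; rewrite -leNgt.
apply: dual_norm_le => x x1; rewrite leNgt; apply/negP => sx.
by apply: no_x; exists x.
Qed.

End DualSeminorm.

(** The Dvoretzky-Rogers lemma for the norm of the dual.  The estimate at z
    comes from duality, evaluation at z being a functional on the dual of norm
    at most |z|. *)
Lemma functional_pair (X : normedModType K) (s : R) :
  ~ finite_dim X -> 0 < s < 1 ->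
  exists (f g : {scalar X}) (x y : X) (a b : R),
    [/\ forall z, rnorm (f z) ^+ 2 + rnorm (g z) ^+ 2 <= rnorm z ^+ 2,
      rnorm x <= 1 /\ rnorm y <= 1, f x = of_real k a /\ g y = of_real k b &
      s < a /\ s < b].
Proof.
move=> Xinf s01; have [n DR] := dvoretzky_rogers k s01.
have [e [f [B [B0 fe fB]]]] := biorthogonal_system n Xinf.
have fB' (i : 'I_n) x : rnorm (f i x) <= B * rnorm x by exact: fB.
have [||c [d [cs ds cd]]] :=
  DR (dual_seminorm fB' B0) (\sum_(i < n) rnorm (e i)).
- move=> c i; have <- : combination (fun i : 'I_n => f i) c (e i) = c i 0.
    rewrite /combination (bigD1 i)//= big1 => [|j /negPf ji].
      by rewrite fe// eqxx mulr1 addr0.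
    by rewrite fe// -[(_ == _)%N]/(j == i) ji mulr0.
  rewrite mulrC; apply: le_trans (combination_le fB' B0 c (e i)) _.
  rewrite ler_wpM2l//; first exact: (seminorm_ge0 (dual_seminorm fB' B0)).
  by rewrite (bigD1 i)//= lerDl sumr_ge0// => j _; exact: rnorm_ge0.
- by apply: sumr_ge0 => i _; exact: rnorm_ge0.
pose F := combination (fun i : 'I_n => f i).
have [g gE] := scalar_of_function (combinationDr (fun i : 'I_n => f i) c)
  (combinationZr (fun i : 'I_n => f i) c).
have [h hE] := scalar_of_function (combinationDr (fun i : 'I_n => f i) d)
  (combinationZr (fun i : 'I_n => f i) d).
have [x0 x01 cx0] := dual_norm_attained fB' B0 cs.
have [y0 y01 dy0] := dual_norm_attained fB' B0 ds.
have [x x1 gx] := rotate_positive g x0.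
have [y y1 hy] := rotate_positive h y0.
exists g, h, x, y, (rnorm (g x0)), (rnorm (h y0)); split.
- move=> z; have [u u1 zu] := polar z.
  have [phi phiE] := @scalar_of_function _ _ (fun c => F c u)
    (fun c d => combinationD _ c d u) (fun a c => combinationZ _ a c u).
  have phi_le v : rnorm (phi v) <= dual_seminorm fB' B0 v.
    by rewrite phiE; exact: (combination_le_unit fB' B0).
  have := functional_pair_le phi_le cd; rewrite !phiE /F -gE -hE => gh.
  have scale (l : {scalar X}) : rnorm (l z) = rnorm z * rnorm (l u).
    by rewrite {1}zu linearZ rnormM rnorm_of_real ger0_norm ?rnorm_ge0.
  rewrite !scale !exprMn -mulrDr -[X in _ <= X]mulr1.
  by rewrite ler_wpM2l ?sqr_ge0.
- by split; [exact: le_trans x1 x01|exact: le_trans y1 y01].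
- by [].
- by rewrite gE hE.
Qed.

End FunctionalPairs.

(** * Bounds for the von Neumann-Jordan constant *)
Section CNJBounds.
Variables (R : realType) (k : field_kind).
Local Notation K := (base_field R k).

Lemma CNJ_le2 (X : completeNormedModType K) : (CNJ X <= 2%:E)%E.
Proof.
apply: ge_ereal_sup => _ [[x y] /= xy <-]; rewrite lee_fin.
have N0 : 0 < rnorm x ^+ 2 + rnorm y ^+ 2.
  rewrite lt_def addr_ge0 ?sqr_ge0// andbT paddr_eq0 ?sqr_ge0// !sqrf_eq0.
  apply/negP => /andP[/eqP x0 /eqP y0]; apply: xy.
  by rewrite (rnorm_eq0 x0) (rnorm_eq0 y0).
rewrite ler_pdivrMr ?mulr_gt0//.
have le_sqr (z : X) : rnorm z <= rnorm x + rnorm y ->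
    rnorm z ^+ 2 <= (rnorm x + rnorm y) ^+ 2.
  by move=> h; apply: lerXn2r; rewrite ?nnegrE ?addr_ge0 ?rnorm_ge0.
have h1 := le_sqr _ (rnormD x y).
have : rnorm (x - y) <= rnorm x + rnorm y.
  by apply: le_trans (rnormD _ _) _; rewrite rnormN.
move=> /le_sqr h2; have := sqr_ge0 (rnorm x - rnorm y); nra.
Qed.

(** For such x and y the quotient is at least (2 - 8 h)^2 / 2 >= 2 - 16 h. *)
Lemma CNJ_eq2 (X : completeNormedModType K) :
  (forall h : R, 0 < h < 1 / 8 -> exists x y : X,
     [/\ rnorm x <= 1, rnorm y <= 1, 2 - 8 * h <= rnorm (x + y) &
         2 - 8 * h <= rnorm (x - y)]) -> CNJ X = 2%:E.
Proof.
move=> sq; apply/le_anti; rewrite CNJ_le2 /=.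
have ge h : 0 < h < 1 / 8 -> ((2 - 16 * h)%:E <= CNJ X)%E.
  move=> /[dup] h01 /sq[x [y [x1 y1 xDy xBy]]]; move/andP: h01 => [h0 h1].
  apply: ereal_sup_ge.
  exists ((rnorm (x + y) ^+ 2 + rnorm (x - y) ^+ 2) /
          (2 * (rnorm x ^+ 2 + rnorm y ^+ 2)))%:E.
    exists (x, y) => //= -[x0 y0]; move: xDy; rewrite x0 y0 addr0 rnorm0; lra.
  rewrite lee_fin.
  have xy : 0 < rnorm x \/ 0 < rnorm y.
    have [x0|x0] := ltP 0 (rnorm x); [by left|right].
    have := rnormD x y; lra.
  have x0 := rnorm_ge0 x; have y0 := rnorm_ge0 y.
  have N0 : 0 < rnorm x ^+ 2 + rnorm y ^+ 2.
    case: xy => xy; [rewrite ltr_pwDl ?exprn_gt0 ?sqr_ge0//|].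
    by rewrite ltr_wpDl ?exprn_gt0 ?sqr_ge0.
  rewrite ler_pdivlMr ?mulr_gt0//.
  have le1 (z : R) : 0 <= z -> z <= 1 -> z ^+ 2 <= 1.
    by move=> z0 z1; rewrite expr_le1.
  have N2 : rnorm x ^+ 2 + rnorm y ^+ 2 <= 2.
    by have := le1 _ x0 x1; have := le1 _ y0 y1; lra.
  have le_sq (z : R) : 2 - 8 * h <= z -> 4 - 32 * h <= z ^+ 2.
    move=> hz; have : (2 - 8 * h) ^+ 2 <= z ^+ 2.
      by apply: lerXn2r => //; rewrite nnegrE; lra.
    have := sqr_ge0 h; nra.
  have := le_sq _ xDy; have := le_sq _ xBy.
  move: N2 N0; move: (rnorm x ^+ 2 + rnorm y ^+ 2) => N N2 N0 e1 e2.
  have : 0 <= (2 - N) * (2 - 16 * h) by rewrite mulr_ge0; lra.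
  lra.
apply/lee_addgt0Pr => e e0.
pose h := Num.min (e / 16) (1 / 16).
have h_le : h <= e / 16 by rewrite /h ge_min lexx.
have h1 : h <= 1 / 16 by rewrite /h ge_min lexx orbT.
have h0 : 0 < h by rewrite /h lt_min; apply/andP; split; lra.
rewrite -leeBlDr//; apply: le_trans (ge h _); last by lra.
by rewrite -EFinB lee_fin; lra.
Qed.

End CNJBounds.

(** * Norms of sums of two elementary tensors *)
Section TensorPairs.
Variables (R : realType) (k : field_kind).
Local Notation K := (base_field R k).
Variables X Y : normedModType K.

Lemma tensZl (a : K) (x : X) (y : Y) : tens (a *: x) y = a *: tens x y.
Proof.
by have := tensor_sumZ a [:: (x, y)]; rewrite /tensor_sum /= !big_seq1.
Qed.

Lemma tensNl (x : X) (y : Y) : tens (- x) y = - tens x y.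
Proof. by rewrite -scaleN1r tensZl scaleN1r. Qed.

Lemma inj_norm_tens (x : X) (y : Y) : rnorm x * rnorm y <= inj_norm (tens x y).
Proof.
have [f fX fx] := hahn_banach x; have [g gY gy] := hahn_banach y.
rewrite (@inj_normE _ _ _ _ _ [:: (x, y)]) ?/tensor_sum ?big_seq1//.
apply: sup_ubound.
  exists (\sum_(q <- [:: (x, y)]) rnorm q.1 * rnorm q.2).
  move=> r [f' [g' [? ? ->]]].
  exact: inj_bounded.
by exists f, g; rewrite big_seq1 rnormM fx gy.
Qed.

Lemma inj_norm_pair (x x' : X) (y y' : Y) :
  weakly_2_contractive x x' -> weakly_2_contractive y y' ->
  inj_norm (tens x y + tens x' y') <= 1.
Proof.
move=> xx yy; rewrite (@inj_normE _ _ _ _ _ [:: (x, y); (x', y')]); last first.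
  by rewrite /tensor_sum big_cons big_seq1.
apply: ge_sup.
  by exists (rnorm (\sum_(q <- [:: (x, y); (x', y')])
    (\0 : {scalar X}) q.1 * (\0 : {scalar Y}) q.2)), \0, \0; split=> //;
    move=> z; rewrite normr0.
move=> _ [f [g [fX gY ->]]]; rewrite big_cons big_seq1 /=.
apply: le_trans (rnormD _ _) _; rewrite !rnormM.
have := xx f fX; have := yy g gY.
have := sqr_ge0 (rnorm (f x) - rnorm (g y)).
have := sqr_ge0 (rnorm (f x') - rnorm (g y')).
nra.
Qed.

Lemma proj_norm_tens (x : X) (y : Y) :
  proj_norm (tens x y) <= rnorm x * rnorm y.
Proof.
apply: ge_inf.
  exists 0 => _ [s _ ->]; apply: sumr_ge0 => q _.
  by rewrite mulr_ge0 ?rnorm_ge0.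
by exists [:: (x, y)]; rewrite ?/tensor_sum ?big_seq1.
Qed.

(** The bilinear form f g + e f' g' has norm at most 1 by the Cauchy-Schwarz
    inequality, and every form of norm at most 1 is bounded by the projective
    norm. *)
Lemma proj_norm_ge (f f' : {scalar X}) (g g' : {scalar Y}) (e : K) w :
  (forall x, rnorm (f x) ^+ 2 + rnorm (f' x) ^+ 2 <= rnorm x ^+ 2) ->
  (forall y, rnorm (g y) ^+ 2 + rnorm (g' y) ^+ 2 <= rnorm y ^+ 2) ->
  rnorm e <= 1 ->
  rnorm (val w (form_mul f g : {bilinear X -> Y -> K | *%R & *%R}) +
         e * val w (form_mul f' g' : {bilinear X -> Y -> K | *%R & *%R}))
    <= proj_norm w.
Proof.
move=> ff gg e1; have [s0 ws0] := tensor_sumP w.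
apply: lb_le_inf; first by exists (\sum_(q <- s0) rnorm q.1 * rnorm q.2), s0.
move=> _ [s -> ->]; rewrite !val_tensor_sum mulr_sumr -big_split /=.
elim: s => [|q s IH]; first by rewrite !big_nil rnorm0.
rewrite !big_cons (le_trans (rnormD _ _))// lerD// /form_mul.
apply: le_trans (rnormD _ _) _; rewrite !rnormM.
have : rnorm e * (rnorm (f' q.1) * rnorm (g' q.2)) <=
    rnorm (f' q.1) * rnorm (g' q.2).
  by rewrite ler_piMl// mulr_ge0 ?rnorm_ge0.
have := ff q.1; have := gg q.2.
move: (rnorm_ge0 q.1) (rnorm_ge0 q.2).
move: (rnorm q.1) (rnorm q.2) (rnorm (f _)) (rnorm (f' _)).
move: (rnorm (g _)) (rnorm (g' _)) => b b' X0 Y0 a a' x0 y0 bb aa h.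
suff : a * b + a' * b' <= X0 * Y0 by lra.
rewrite leNgt; apply/negP => lt_ab.
have : (X0 * Y0) ^+ 2 < (a * b + a' * b') ^+ 2.
  by rewrite ltrXn2r ?nnegrE ?mulr_ge0// (le_trans _ (ltW lt_ab))// mulr_ge0.
have : (a ^+ 2 + a' ^+ 2) * (b ^+ 2 + b' ^+ 2) <= X0 ^+ 2 * Y0 ^+ 2.
  by apply: ler_pM; rewrite ?addr_ge0 ?sqr_ge0.
have := sqr_ge0 (a * b' - a' * b); nra.
Qed.

End TensorPairs.

(** * The von Neumann-Jordan constant of tensor products *)
Section TensorCNJ.
Variables (R : realType) (k : field_kind).
Local Notation K := (base_field R k).

Lemma CNJ_completion_eq2 (V : lmodType K) (p : seminorm V) :
  (forall h : R, 0 < h < 1 / 8 -> exists u v : V,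
     [/\ p u <= 1, p v <= 1, 2 - 8 * h <= p (u + v) &
         2 - 8 * h <= p (u - v)]) ->
  CNJ (completion p) = 2%:E.
Proof.
move=> sq; apply: CNJ_eq2 => h /sq[u [v [u1 v1 uDv uBv]]].
exists (to_completion p u), (to_completion p v).
by rewrite -linearD -linearB /= !rnorm_to_completion.
Qed.

Variables X Y : completeNormedModType K.
Hypotheses (Xinf : ~ finite_dim X) (Yinf : ~ finite_dim Y).

Lemma CNJ_inj_tensor : CNJ (inj_tensor X Y) = 2%:E.
Proof.
apply: CNJ_completion_eq2 => h /andP[h0 h1].
have s01 : 0 < 1 - h < 1 by apply/andP; split; lra.
have [x [x' [xs xs' xx]]] := vector_pair Xinf s01.
have [y [y' [ys ys' yy]]] := vector_pair Yinf s01.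
exists (tens x y + tens x' y'), (tens x y - tens x' y').
have xNx : weakly_2_contractive x (- x').
  by move=> f fB; rewrite linearN rnormN; exact: xx.
have large (a : X) (b : Y) : 1 - h < rnorm a -> 1 - h < rnorm b ->
    2 - 8 * h <= inj_norm (tens a b *+ 2).
  move=> sa sb; rewrite -(scaler_nat 2 (tens a b)) inj_normZ.
  have -> : (2%:R : K) = of_real k 2.
    by rewrite -[2%:R]/(1 + 1) -[2 in RHS]/(1 + 1) of_realD of_real1.
  rewrite rnorm_of_real ger0_norm//.
  have := inj_norm_tens a b.
  have : (1 - h) * (1 - h) <= rnorm a * rnorm b by rewrite ler_pM ?ltW//; lra.
  have := sqr_ge0 h; nra.
split.
- exact: inj_norm_pair.
- by rewrite -tensNl; exact: inj_norm_pair.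
- by rewrite addrACA subrr addr0 -mulr2n; exact: large.
- by rewrite opprB (addrC (tens x y + _)) subrKA -mulr2n; exact: large.
Qed.

Lemma CNJ_proj_tensor : CNJ (proj_tensor X Y) = 2%:E.
Proof.
apply: CNJ_completion_eq2 => h /andP[h0 h1].
have s01 : 0 < 1 - h < 1 by apply/andP; split; lra.
have ge_sq (A B : R) : 1 - h < A -> 1 - h < B -> 1 - 2 * h <= A * B.
  move=> hA hB; have := sqr_ge0 h.
  by have : (1 - h) * (1 - h) <= A * B; [rewrite ler_pM ?ltW//; lra|lra].
have [f [f' [x [x' [a [a' [ff [x1 x1'] [fx fx'] [sa sa']]]]]]]] :=
  functional_pair Xinf s01.
have [g [g' [y [y' [b [b' [gg [y1 y1'] [gy gy'] [sb sb']]]]]]]] :=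
  functional_pair Yinf s01.
have unit_tens (z : X) (w : Y) : rnorm z <= 1 -> rnorm w <= 1 ->
    proj_norm (tens z w) <= 1.
  move=> z1 w1; apply: le_trans (proj_norm_tens _ _) _.
  by rewrite mulr_ile1 ?rnorm_ge0.
(* if |f x| is close to 1, the estimate on f and f' forces f' x to be small *)
have off_diag (A B C : R) : 0 <= A -> A <= 1 -> 0 <= B -> 1 - h < C ->
    C ^+ 2 + B ^+ 2 <= A ^+ 2 -> B ^+ 2 <= 2 * h.
  move=> A0 A1 B0 hC CB.
  have : A ^+ 2 <= 1 by rewrite expr_le1.
  have : (1 - h) ^+ 2 <= C ^+ 2 by apply: lerXn2r; rewrite ?nnegrE; lra.
  have := sqr_ge0 h; nra.
have a0 : 0 <= a by lra.
have a0' : 0 <= a' by lra.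
have b0 : 0 <= b by lra.
have b0' : 0 <= b' by lra.
have f'x : rnorm (f' x) ^+ 2 <= 2 * h.
  apply: (off_diag (rnorm x) _ a) => //; rewrite ?rnorm_ge0//.
  by have := ff x; rewrite fx rnorm_of_real ger0_norm.
have fx2 : rnorm (f x') ^+ 2 <= 2 * h.
  apply: (off_diag (rnorm x') _ a') => //; rewrite ?rnorm_ge0//.
  by have := ff x'; rewrite fx' rnorm_of_real ger0_norm// addrC.
have g'y : rnorm (g' y) ^+ 2 <= 2 * h.
  apply: (off_diag (rnorm y) _ b) => //; rewrite ?rnorm_ge0//.
  by have := gg y; rewrite gy rnorm_of_real ger0_norm.
have gy2 : rnorm (g y') ^+ 2 <= 2 * h.
  apply: (off_diag (rnorm y') _ b') => //; rewrite ?rnorm_ge0//.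
  by have := gg y'; rewrite gy' rnorm_of_real ger0_norm// addrC.
have prod_le (A B : R) : A ^+ 2 <= 2 * h -> B ^+ 2 <= 2 * h -> A * B <= 2 * h.
  by move=> hA hB; have := sqr_ge0 (A - B); nra.
(* e is 1 or -1; the form used against the tensor has the same sign e, which
   makes both diagonal terms positive *)
have large (e : K) : rnorm e = 1 -> e * e = 1 ->
    2 - 8 * h <= proj_norm (tens x y + e *: tens x' y').
  move=> e1 ee.
  have e_le : rnorm e <= 1 by rewrite e1.
  apply: le_trans (proj_norm_ge (tens x y + e *: tens x' y') ff gg e_le).
  have valE (B : {bilinear X -> Y -> K | *%R & *%R}) :
      val (tens x y + e *: tens x' y') B = B x y + e * B x' y' by [].
  rewrite !valE /= /form_mul fx gy fx' gy'.
  have re_ge (c : K) : - rnorm c <= re_part c.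
    have := re_part_le_rnorm (- c); have := re_partD c (- c).
    by rewrite subrr re_part0 rnormN; lra.
  have fg : rnorm (e * (f x' * g y')) <= 2 * h.
    by rewrite !rnormM e1 mul1r prod_le.
  have fg' : rnorm (e * (f' x * g' y)) <= 2 * h.
    by rewrite !rnormM e1 mul1r prod_le.
  rewrite mulrDr [e * (e * _)]mulrA ee mul1r -!of_realM.
  apply: le_trans (re_part_le_rnorm _); rewrite !re_partD !of_realK.
  have := re_ge (e * (f x' * g y')); have := re_ge (e * (f' x * g' y)).
  have := ge_sq a b sa sb; have := ge_sq a' b' sa' sb'.
  lra.
have N1 : rnorm (-1 : K) = 1 by rewrite rnormN rnorm1.
exists (tens x y), (tens x' y'); split; first 2 last.
- by have := large 1 (rnorm1 _ _) (mulr1 _); rewrite scale1r.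
- by have := large (-1) N1; rewrite mulrNN mulr1 scaleN1r; exact.
- exact: unit_tens.
- exact: unit_tens.
Qed.

End TensorCNJ.

Theorem theorem3p4 (R : realType) (k : field_kind)
    (X Y : completeNormedModType (base_field R k)) :
  (~ finite_dim X -> ~ finite_dim Y ->
     CNJ (inj_tensor X Y) = 2%:E /\ CNJ (proj_tensor X Y) = 2%:E) /\
  (CNJ (inj_tensor X Y) <> CNJ (proj_tensor X Y) ->
     finite_dim X \/ finite_dim Y).
Proof.
have eq2 : ~ finite_dim X -> ~ finite_dim Y ->
    CNJ (inj_tensor X Y) = 2%:E /\ CNJ (proj_tensor X Y) = 2%:E.
  by move=> Xinf Yinf; split; [exact: CNJ_inj_tensor|exact: CNJ_proj_tensor].
split; first exact: eq2.
move=> neq; apply: contrapT => /not_orP[Xinf Yinf].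
by have [e1 e2] := eq2 Xinf Yinf; exact: neq (etrans e1 (esym e2)).
Qed.
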